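(* Suppose that $a,b,c,d$ are non-zero integers, and let $$I(a,b,c,d)=\int_0^1\int_0^1|h(a\alpha)h(b\beta)h(c\alpha+d\beta)|^7\,d\alpha\,d\beta .$$ Then for each $\varepsilon>0$ one has $$I(a,b,c,d)\ll P^{13+\frac12\Delta_{10}+\varepsilon}.$$
   Context: Write $e(z)=e^{2\pi i z}$. For $1\leqslant R\leqslant P$ let $\mathcal{A}(P,R)=\{n\in\mathbb{Z}\cap[1,P]: p \text{ prime and } p\mid n\Rightarrow p\leqslant R\}$, and let $h(\alpha)=h(\alpha;P,R)=\sum_{x\in\mathcal{A}(P,R)}e(\alpha x^4)$. Put $\Delta_7=0.849408$, $\Delta_{10}=0.213431$, $\Delta_{12}=0$. It is known that there is a positive number $\eta$ such that, for each $t\in\{7,10,12\}$, one has $\int_0^1|h(\alpha;P,R)|^t\,d\alpha\ll P^{t-4+\Delta_t}$ whenever $1\leqslant R\leqslant P^\eta$. Throughout, such a (sufficiently small) $\eta>0$ is fixed and $R=P^\eta$. The parameter $P$ is a sufficiently large positive number; implicit constants in $\ll$ may depend on $\varepsilon$, on the fixed $\eta$ and on the coefficients $a,b,c,d$, but not on $P$. *)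

(* Defs.v *)
From HB Require Import structures.
From mathcomp Require Import all_boot all_order all_algebra.
From mathcomp Require Import complex.
From mathcomp Require Import all_classical all_reals all_analysis.

Set Implicit Arguments.
Unset Strict Implicit.
Unset Printing Implicit Defensive.

Import Order.TTheory GRing.Theory Num.Theory.
Import numFieldNormedType.Exports.

Local Open Scope classical_set_scope.
Local Open Scope ring_scope.
Local Open Scope complex_scope.

(* e(z) = exp(2 pi i z) for real z *)
Definition e {R : realType} (z : R) : R[i] :=
  cos (2 * pi * z) +i* sin (2 * pi * z).

(* The smoothness bound is called Y throughout, R being the type of reals. *)
Definition smooth {R : realType} (P Y : R) : set nat :=
  [set n | [/\ (0 < n)%N, n%:R <= P &
    forall p : nat, prime p -> (p %| n)%N -> p%:R <= Y]].

(* A big operator over a classical set is the neutral element when the set is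
   not finite, so this is what makes the sum defining h meaningful. *)
Lemma finite_smooth {R : realType} (P Y : R) : finite_set (smooth P Y).
Proof.
apply: (@sub_finite_set _ _ `I_(Num.truncn P).+1); last exact: finite_II.
by move=> n [n0 nP _] /=; rewrite ltnS truncn_ge_nat // (le_trans _ nP).
Qed.

Definition h {R : realType} (P Y alpha : R) : R[i] :=
  \sum_(x \in smooth P Y) e (alpha * x%:R ^+ 4).

(* normc is the R-valued modulus; the generic norm on R[i] is R[i]-valued *)
Definition absh {R : realType} (P Y alpha : R) : R :=
  ComplexField.Normc.normc (h P Y alpha).

Definition moment {R : realType} (t : nat) (P Y : R) : \bar R :=
  (\int[lebesgue_measure]_(alpha in `[0%R, 1%R]) (absh P Y alpha ^+ t)%:E)%E.

(* 0.849408, 0.213431 and 0; the decimals are split into blocks of three digits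
   because numerals are built on unary naturals. Values of t other than
   7, 10, 12 are never used. *)
Definition Delta {R : realType} (t : nat) : R :=
  match t with
  | 7 => 849%:R / 10 ^+ 3 + 408%:R / 10 ^+ 6
  | 10 => 213%:R / 10 ^+ 3 + 431%:R / 10 ^+ 6
  | _ => 0
  end.

Definition admissible {R : realType} (eta : R) : Prop :=
  forall t : nat, t \in [:: 7; 10; 12]%N ->
  exists C P0 : R, forall P Y : R, P0 <= P -> 1 <= P -> 1 <= Y <= P `^ eta ->
    (moment t P Y <= (C * P `^ (t%:R - 4 + Delta t))%:E)%E.

Definition entangled {R : realType} (P Y : R) (a b c d : int) : \bar R :=
  (\int[lebesgue_measure]_(alpha in `[0%R, 1%R])
   \int[lebesgue_measure]_(beta in `[0%R, 1%R])
     ((absh P Y (a%:~R * alpha) * absh P Y (b%:~R * beta)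
       * absh P Y (c%:~R * alpha + d%:~R * beta)) ^+ 7)%:E)%E.

(* Main.v *)
Require Import Defs.
From mathcomp Require Import all_boot all_order all_algebra.
From mathcomp Require Import all_classical all_reals all_analysis.
From mathcomp Require Import complex zify ring lra.

(** Put [f] for [|h|].  The idea is to pass to the Fourier coefficients
    of [f ^ 7] and to bound their cubic moment.

    All integrals are first replaced by averages over the points [z / p], with
    [p] a prime chosen very large in terms of [P].  The integrands are Lipschitz,
    so the error is at most 1, and Fourier analysis on ['F_p] is a matter of
    finite sums.  As [h (- alpha)] is the conjugate of [h alpha], the function
    [f ^ 7] is even and its coefficients [psi n] ([coef]), the averages
    of [f z ^ 7 * cos (2 pi n z / p)], are real.  Expanding the entangled average
    gives the sum over [n] of [psi n * psi (u n) * psi (v n)] with [u], [v]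
    invertible modulo [p] ([trilinear]), hence at most the sum of [|psi n| ^ 3]
    ([entangled_discrete]).

    For the cubic moment fix a level [T] and let [Z] be the number of [n] with
    [|psi n| >= T].  Testing against [k z], the sum over these [n] of
    [sg (psi n) * cos (2 pi n z / p)], gives [T Z <= X] where [X] is the average
    of [f ^ 7 * k].  Let [V] be the average of [f ^ 4 * k ^ 2] and [A_t] that of
    [f ^ t].  Three applications of Cauchy-Schwarz give [X ^ 2 <= A_10 * V] and
    [X ^ 4 <= A_12 ^ 2 * V * Z], hence [X ^ 6 <= A_10 * A_12 ^ 2 * V ^ 2 * Z]
    ([twist_bounds]).

    By orthogonality [V] is at most the number of solutions of
    [x ^ 4 - y ^ 4 + n = x' ^ 4 - y' ^ 4 + n'] with [n], [n'] in the level set.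
    Weyl differencing, carried out as a count, shows that this is
    [O (P ^ 3 * Z + P ^ (2 + eps) * Z ^ (3 / 2))] ([quartic_collisions_bound]):
    Cauchy-Schwarz reduces to [x - y = x' - y'], a second application brings in
    the third difference of [t ^ 4], which is a product of linear factors, and
    the divisor bound then counts its representations.

    If the first term dominates then [T ^ 2 * Z] is at most a constant times
    [A_10 * P ^ 3], and [T <= A_7] bounds [T ^ 3 * Z] by
    [P ^ (12 + Delta_7 + Delta_10)], which is admissible because
    [Delta_7 + Delta_10 / 2 <= 1].  If the second dominates then
    [T ^ 6 * Z ^ 2] is at most a constant times
    [A_10 * A_12 ^ 2 * P ^ (4 + eps)], which has order
    [P ^ (26 + Delta_10 + eps)].  Adding up over boundedly many levels
    [T = P ^ (3 + i * delta)], and using Parseval and [A_14 <= P ^ 2 * A_12] for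
    the coefficients below [P ^ 3], completes the proof ([cubic_moment]). *)

Import Order.TTheory GRing.Theory Num.Theory.
Import numFieldNormedType.Exports.

Local Open Scope ring_scope.

(** * Divisor bound *)

Local Open Scope nat_scope.

(** A divisor [d] of [m * n] is recovered from [gcdn d m], which divides [m],
    and the cofactor [d %/ gcdn d m], which divides [n]. *)
Lemma size_divisors_mul (m n : nat) : 0 < m -> 0 < n ->
  size (divisors (m * n)) <= size (divisors m) * size (divisors n).
Proof.
move=> m0 n0; rewrite -(size_allpairs muln).
apply: uniq_leq_size; first exact: divisors_uniq.
move=> d; rewrite -dvdn_divisors ?muln_gt0 ?m0 // => dmn.
have g0 : 0 < gcdn d m by rewrite gcdn_gt0 m0 orbT.
apply/allpairsP; exists (gcdn d m, d %/ gcdn d m) => /=; split.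
- by rewrite -dvdn_divisors // dvdn_gcdr.
- rewrite -dvdn_divisors // -(@Gauss_dvdr _ (m %/ gcdn d m)).
    rewrite -(@dvdn_pmul2r (gcdn d m)) // divnK ?dvdn_gcdl //.
    by rewrite mulnAC divnK ?dvdn_gcdr.
  rewrite /coprime -(eqn_pmul2r g0) mul1n muln_gcdl !divnK ?dvdn_gcdl ?dvdn_gcdr //.
- by rewrite mulnC divnK // dvdn_gcdl.
Qed.

Lemma size_divisors_pfactor (p e : nat) : prime p ->
  size (divisors (p ^ e)) <= e.+1.
Proof.
move=> pp; have <- : size [seq p ^ i | i <- iota 0 e.+1] = e.+1.
  by rewrite size_map size_iota.
apply: uniq_leq_size; first exact: divisors_uniq.
move=> d; rewrite -dvdn_divisors ?expn_gt0 ?prime_gt0 //.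
case/(dvdn_pfactor _ _ pp) => i ie ->; apply/map_f; by rewrite mem_iota.
Qed.

(** Write [e] as [k * q + r]: then [e.+1 <= k * q.+1 <= k * 2 ^ q]. *)
Lemma succn_exp_le (k e : nat) : e.+1 ^ k <= k ^ k * 2 ^ e.
Proof.
case: k => [|k]; first by rewrite !expn0 mul1n expn_gt0.
set K := k.+1; have K0 : 0 < K by [].
have h1 : e.+1 <= K * 2 ^ (e %/ K).
  apply: (@leq_trans (K * (e %/ K).+1)); first by rewrite mulnC ltn_ceil.
  by rewrite leq_mul2l ltn_expl // orbT.
apply: (@leq_trans ((K * 2 ^ (e %/ K)) ^ K)); first by rewrite leq_exp2r.
rewrite expnMn leq_mul2l -expnM leq_exp2l // leq_divM orbT //.
Qed.

(** A prime factor [p >= 2 ^ k] at most doubles the number of divisors, so it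
    multiplies the left side by at most [2 ^ k <= p]. *)
Lemma divisor_bound_rough (k n : nat) : 0 < n ->
  (forall p, p \in primes n -> 2 ^ k <= p) -> size (divisors n) ^ k <= n.
Proof.
elim/ltn_ind: n => n IH n0 big.
case: (ltngtP n 1) => [|n1|->]; first by rewrite ltnNge n0.
  have pp := pdiv_prime n1; set p := pdiv n in pp.
  have pn : p %| n := pdiv_dvd n.
  have m0 : 0 < n %/ p by rewrite divn_gt0 ?prime_gt0 // dvdn_leq.
  have IHm : size (divisors (n %/ p)) ^ k <= n %/ p.
    apply: IH => //; first by rewrite ltn_Pdiv // prime_gt1.
    move=> q; rewrite mem_primes => /and3P[pq _ qn]; apply: big.
    by rewrite mem_primes pq n0 (dvdn_trans qn) // dvdn_div.
  rewrite -{1}(divnK pn) mulnC -{2}(divnK pn) (mulnC _ p).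
  apply: (@leq_trans ((2 * size (divisors (n %/ p))) ^ k)).
    case: (k) => // k'; rewrite leq_exp2r //.
    apply: leq_trans (size_divisors_mul _ _ (prime_gt0 pp) m0) _.
    by have := size_divisors_pfactor p 1 pp; rewrite expn1 leq_mul2r => ->; rewrite orbT.
  by rewrite expnMn leq_mul // big // mem_primes pp n0 pn.
by rewrite exp1n.
Qed.

(** The divisor bound [tau n = O (n ^ (1 / k))], in a form that stays within
    [nat].  The finitely many primes below [2 ^ k] are treated one at a time, in
    decreasing order; the full power of such a prime dividing [n] costs a factor
    [k ^ k] by [succn_exp_le]. *)
Lemma divisor_bound (k : nat) :
  exists C : nat, forall n, 0 < n -> size (divisors n) ^ k <= C * n.
Proof.
(* [j] is the number of small primes, counted down from [2 ^ k], that are allowed *)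
suff H j : exists C : nat, forall n, 0 < n ->
    (forall p, p \in primes n -> 2 ^ k - j <= p) ->
    size (divisors n) ^ k <= C * n.
  have [C hC] := H (2 ^ k); exists C => n n0; apply: hC => // p _.
  by rewrite subnn.
elim: j => [|j [C hC]].
  by exists 1 => n n0 big; rewrite mul1n divisor_bound_rough // => p /big; rewrite subn0.
exists (k ^ k * C) => n n0 big.
set b := 2 ^ k - j.+1.
have hb : 2 ^ k - j <= b.+1 by rewrite /b subnS leqSpred.
have [pb|npb] := boolP (prime b); last first.
  have hn : size (divisors n) ^ k <= C * n.
    apply: hC => // p pn; apply: leq_trans hb _.
    rewrite ltn_neqAle big // andbT; apply: contraNneq npb => ->.
    by move: pn; rewrite mem_primes => /and3P[].
  apply: leq_trans hn _; rewrite -mulnA leq_pmull //.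
  by case: (k) => // k'; rewrite expn_gt0.
have [m cpm nE] := pfactor_coprime pb n0.
have m0 : 0 < m by move: n0; rewrite nE muln_gt0 => /andP[].
have hm : size (divisors m) ^ k <= C * m.
  apply: hC => // p; rewrite mem_primes => /and3P[pp _ pm].
  apply: leq_trans hb _; rewrite ltn_neqAle big ?andbT; last first.
    by rewrite mem_primes pp n0 nE dvdn_mulr.
  apply: contraTneq pm => <-; by rewrite -prime_coprime.
set e := logn b n in nE *.
rewrite {1}nE mulnC.
have pe0 : 0 < b ^ e by rewrite expn_gt0 prime_gt0.
apply: (@leq_trans ((e.+1 * size (divisors m)) ^ k)).
  case: (k) => // k'; rewrite leq_exp2r //.
  apply: leq_trans (size_divisors_mul _ _ pe0 m0) _.
  by rewrite leq_mul2r size_divisors_pfactor ?orbT.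
rewrite expnMn nE (mulnC m) (mulnACA (k ^ k)) leq_mul //.
apply: leq_trans (succn_exp_le _ _) _.
rewrite leq_mul2l; apply/orP; right.
by case: (e) => // e'; rewrite leq_exp2r // prime_gt1.
Qed.

(** * Counting collisions *)

Local Open Scope ring_scope.

Lemma sqr_sum_card_le (I : finType) (B : {set I}) (c : I -> nat) :
  ((\sum_(i in B) c i) ^ 2 <= #|B| * \sum_(i in B) c i ^ 2)%N.
Proof.
rewrite -(leq_pmul2l (isT : 0 < 2)%N).
have -> : ((\sum_(i in B) c i) ^ 2 = \sum_(i in B) \sum_(j in B) c i * c j)%N.
  by rewrite -mulnn big_distrl /=; apply: eq_bigr => i _; rewrite big_distrr.
have -> : (2 * (#|B| * \sum_(i in B) c i ^ 2)
    = \sum_(i in B) \sum_(j in B) (c i ^ 2 + c j ^ 2))%N.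
  under [RHS]eq_bigr => i _ do rewrite big_split /= sum_nat_const.
  by rewrite big_split /= sum_nat_const -big_distrr /= mul2n addnn.
rewrite big_distrr /=; apply: leq_sum => i _.
rewrite big_distrr /=; apply: leq_sum => j _.
exact: nat_Cauchy.
Qed.

(** The ordered pairs, diagonal included, on which [phi] takes equal values.
    Their number is the second moment of the fibre sizes of [phi]. *)
Definition collisions {I : finType} {M : eqType} (A : {set I}) (phi : I -> M) : {set I * I} :=
  [set ij | [&& ij.1 \in A, ij.2 \in A & phi ij.1 == phi ij.2]].

Lemma collisionsP (I : finType) (M : eqType) (A : {set I}) (phi : I -> M) (ij : I * I) :
  reflect [/\ ij.1 \in A, ij.2 \in A & phi ij.1 = phi ij.2] (ij \in collisions A phi).
Proof. by rewrite inE; apply: (iffP and3P) => -[? ? /eqP]. Qed.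

Lemma card_collisions (I M : finType) (A : {set I}) (phi : I -> M) :
  #|collisions A phi| = (\sum_m #|[set i in A | phi i == m]| ^ 2)%N.
Proof.
rewrite -sum1_card (partition_big (fun ij => phi ij.1) xpredT) //=.
apply: eq_bigr => m _.
rewrite -mulnn -cardsX -sum1_card; apply: eq_bigl => -[i j] /=.
rewrite !inE /=; case: (i \in A); case: (j \in A) => //=; rewrite ?andbF //.
by rewrite andbC; case: (phi i =P m) => //= ->; rewrite eq_sym.
Qed.

(** Cauchy-Schwarz as a statement about counting: one may insist that colliding
    elements carry the same label, at the cost of the number of labels. *)
Lemma collisions_label (I L M : finType) (A : {set I}) (B : {set L})
    (phi : I -> M) (lam : I -> L) : {in A, forall i, lam i \in B} ->
  (#|collisions A phi| <= #|B| * #|collisions A (fun i => (lam i, phi i))|)%N.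
Proof.
move=> AB; rewrite !card_collisions -(pair_bigA_idem _ (fun l m => #|[set i in A | (lam i, phi i) == (l, m)]| ^ 2)%N) //=.
rewrite exchange_big /= big_distrr /=; apply: leq_sum => m _.
have -> : #|[set i in A | phi i == m]| =
    (\sum_(l in B) #|[set i in A | (lam i, phi i) == (l, m)]|)%N.
  rewrite -sum1_card (partition_big lam (mem B)) /=; last first.
    by move=> i; rewrite inE => /andP[/AB].
  apply: eq_bigr => l _; rewrite -sum1_card; apply: eq_bigl => i.
  by rewrite !inE -andbA xpair_eqE; congr (_ && _); rewrite andbC.
apply: leq_trans (sqr_sum_card_le _ _ _) _; rewrite leq_mul2l; apply/orP; right.
by rewrite [leqRHS](bigID (mem B)) /= leq_addr.
Qed.

Lemma card_sqr_label (I L : finType) (A : {set I}) (B : {set L})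
    (lam : I -> L) : {in A, forall i, lam i \in B} ->
  (#|A| ^ 2 <= #|B| * #|collisions A lam|)%N.
Proof.
move=> AB; have := @collisions_label I L unit A B (fun=> tt) lam AB.
have -> : #|collisions A (fun=> tt)| = (#|A| ^ 2)%N.
  by rewrite -mulnn -cardsX; apply: eq_card => -[i j]; rewrite !inE /= andbT.
move=> /leq_trans; apply; rewrite leq_mul2l; apply/orP; right.
by apply: subset_leq_card; apply/fintype.subsetP => -[i j]; rewrite !inE /= xpair_eqE eqxx andbT.
Qed.

Lemma card_fibre (I J : finType) (A : {set I}) (B : {set J}) (g : I -> J) (D : nat) :
  {in A, forall i, g i \in B} ->
  (forall j, j \in B -> #|[set i in A | g i == j]| <= D)%N ->
  (#|A| <= #|B| * D)%N.
Proof.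
move=> AB hD; rewrite -sum1_card (partition_big g (mem B)) //=.
rewrite -sum_nat_const; apply: leq_sum => j jB.
apply: leq_trans (hD _ jB); rewrite -sum1_card.
by rewrite leq_eqVlt; apply/orP; left; apply/eqP; apply: eq_bigl => i; rewrite inE.
Qed.

Lemma card_inj_on (I J : finType) (A : {set I}) (B : {set J}) (g : I -> J) :
  {in A, forall i, g i \in B} -> {in A &, injective g} -> (#|A| <= #|B|)%N.
Proof.
move=> AB gi; rewrite -(card_in_imset gi); apply: subset_leq_card.
by apply/fintype.subsetP => _ /imsetP[i iA ->]; exact: AB.
Qed.

(** * Quadruples of fourth powers with prescribed sums *)

Lemma intr_Fp_eq0 (p : nat) (m : int) : prime p -> (`|m| < p)%N ->
  m%:~R = 0 :> 'F_p -> m = 0.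
Proof.
move=> pp mp m0; have : (`|m|%N)%:R = 0 :> 'F_p.
  apply/eqP; move/eqP: m0; rewrite {1}[m]intEsign rmorphM rmorphXn rmorphN1 /=.
  by rewrite mulf_eq0 signr_eq0.
move/eqP; rewrite -(dvdn_pcharf (pchar_Fp pp)) => pi.
by apply/eqP; rewrite -absz_eq0; apply: contraTT pi => m0'; rewrite gtnNdvd // lt0n.
Qed.

Lemma intr_Fp_inj (p : nat) (i j : int) : prime p -> (`|i - j| < p)%N ->
  i%:~R = j%:~R :> 'F_p -> i = j.
Proof.
move=> pp ij e; apply/eqP; rewrite -subr_eq0; apply/eqP/(@intr_Fp_eq0 p) => //.
by rewrite rmorphB /= e subrr.
Qed.

(** The integer [x - y] of [-N, N], shifted by [N] so as to be an ordinal. *)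
Definition diff_label (N x y : nat) : 'I_(2 * N).+1 := inord (x + N - y).

Lemma diff_label_eq (N x y x' y' : nat) : (x <= N)%N -> (y <= N)%N -> (x' <= N)%N -> (y' <= N)%N ->
  diff_label N x y = diff_label N x' y' -> (x%:Z - y%:Z = x'%:Z - y'%:Z).
Proof.
move=> h1 h2 h3 h4 /(congr1 (@nat_of_ord _)); rewrite !inordK; lia.
Qed.

Lemma card_diff_label_dvd (N m : nat) : (0 < m)%N ->
  (#|[set u : 'I_(2 * N).+1 | `|(u : nat)%:Z - N%:Z|%N %| m]| <= 2 * size (divisors m))%N.
Proof.
move=> m0.
have -> : (2 * size (divisors m))%N =
  size ([seq N + d | d <- divisors m] ++ [seq N - d | d <- divisors m])%N.
  by rewrite size_cat !size_map mul2n addnn.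
rewrite cardE -(size_map val); apply: uniq_leq_size.
  by rewrite map_inj_uniq ?enum_uniq //; exact: val_inj.
move=> v /mapP[u]; rewrite mem_enum inE => um ->.
rewrite mem_cat; apply/orP; have [le|lt] := leqP N u; [left|right].
  apply/mapP; exists `|(u : nat)%:Z - N%:Z|%N; [by rewrite -dvdn_divisors|move=> /=; lia].
apply/mapP; exists `|(u : nat)%:Z - N%:Z|%N; [by rewrite -dvdn_divisors|move=> /=; lia].
Qed.

Definition quartic {p N : nat} (t : 'I_N.+1 * 'I_N.+1 * 'F_p) : 'F_p :=
  t.1.1%:R ^+ 4 - t.1.2%:R ^+ 4 + t.2.

Definition fourth_gap (x y x' y' : nat) : int :=
  x%:Z ^+ 4 - y%:Z ^+ 4 - x'%:Z ^+ 4 + y'%:Z ^+ 4.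

Lemma fourth_gap_degenerate (x y y' : nat) : 
  x%:Z - y%:Z = x%:Z - y'%:Z -> fourth_gap x y x y' = 0.
Proof.
rewrite /fourth_gap => e; have -> : y' = y by lia.
by ring. Qed.

(** With [h = x - y], [k = x - x'] and [j = x - u], the left side is the third
    difference of [t ^ 4] with steps [h], [k], [j].  It equals
    [12 * h * k * j * (2 * x - h - k - j)], and the last factor is the sum of the
    two extreme points, [x] and [v'], of the cube of points involved. *)
Lemma third_difference (x y x' y' u v u' v' : nat) :
  x%:Z - y%:Z = x'%:Z - y'%:Z -> x%:Z - y%:Z = u%:Z - v%:Z ->
  u%:Z - v%:Z = u'%:Z - v'%:Z -> x%:Z - x'%:Z = u%:Z - u'%:Z ->
  fourth_gap x y x' y' - fourth_gap u v u' v' =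
   12 * (x%:Z - y%:Z) * (x%:Z - x'%:Z) * (x%:Z - u%:Z) * (x%:Z + v'%:Z).
Proof.
rewrite /fourth_gap => e1 e2 e3 e4.
have -> : y%:Z = x%:Z - (u%:Z - v%:Z) by lia.
have -> : x'%:Z = x%:Z - (u%:Z - u'%:Z) by lia.
have -> : y'%:Z = x%:Z - (u%:Z - v%:Z) - (u%:Z - u'%:Z) by lia.
have -> : v%:Z = u%:Z - u'%:Z + v'%:Z by lia.
ring.
Qed.

Lemma third_difference_eq0 (x y x' u v : nat) :
  12 * (x%:Z - y%:Z) * (x%:Z - x'%:Z) * (x%:Z - u%:Z) * (x%:Z + v%:Z) = 0 ->
  x != y -> x != x' -> (0 < x)%N -> x%:Z = u%:Z.
Proof.
by move/eqP; rewrite !mulf_eq0 => + /eqP n1 /eqP n2 x0; lia.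
Qed.

(** Throughout this section [p] exceeds the size of all the integers that are
    compared, so that congruences modulo [p] between them are equalities. *)
Section Quartic.
Variables (p N : nat) (A : {set 'I_N.+1}) (Zs : {set 'F_p}) (D : nat).
Hypothesis pp : prime p.
Hypothesis A0 : ord0 \notin A.
Hypothesis Np : (8 * N ^ 4 < p)%N.
Hypothesis hD : forall m, (0 < m <= 4 * N ^ 4)%N -> ((2 * size (divisors m)) ^ 3 <= D)%N.

Let I := ('I_N.+1 * 'I_N.+1 * 'F_p)%type.
Let AI : {set I} := [set t | [&& t.1.1 \in A, t.1.2 \in A & t.2 \in Zs]].

Lemma mem_gt0 (x : 'I_N.+1) : x \in A -> (0 < x)%N.
Proof.
by move=> xA; rewrite lt0n; apply: contraNneq A0 => x0; rewrite (_ : ord0 = x) //; apply: val_inj.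
Qed.

Lemma card_le_bound : (#|A| <= N)%N.
Proof.
have : (#|A| <= #|[set~ (ord0 : 'I_N.+1)]|)%N.
  apply: subset_leq_card; apply/fintype.subsetP => x xA; rewrite !inE.
  by apply: contraNneq A0 => <-.
by rewrite cardsC1 card_ord.
Qed.

Lemma fourth_gap_bound (x y x' y' : nat) : (x <= N)%N -> (y <= N)%N -> (x' <= N)%N -> (y' <= N)%N ->
  (`|fourth_gap x y x' y'| <= 2 * N ^ 4)%N.
Proof.
have H z : (z <= N)%N -> z%:Z ^+ 4 <= (N ^ 4)%N%:Z.
  move=> zN; have -> : z%:Z ^+ 4 = (z ^ 4)%N by rewrite !exprS !expnS !PoszM.
  by rewrite lez_nat leq_exp2r.
have H0 (z : nat) : 0 <= z%:Z ^+ 4 by rewrite exprn_ge0.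
rewrite /fourth_gap => /H a1 /H a2 /H a3 /H a4.
move: (H0 x) (H0 y) (H0 x') (H0 y') a1 a2 a3 a4.
set a := _ ^+ 4; set b := _ ^+ 4; set c := _ ^+ 4; set d := _ ^+ 4; set e := (N ^ 4)%N.
lia.
Qed.

(** The elements of [para] are the solutions of
    [x ^ 4 - y ^ 4 + n = x' ^ 4 - y' ^ 4 + n'] that also satisfy
    [x - y = x' - y']; in [nondeg] neither [x = y] nor [x = x']. *)
Let gap (t : I) := diff_label N t.1.1 t.1.2.
Let para : {set I * I} := collisions AI (fun t => (gap t, quartic t)).
Let nondeg : {set I * I} := [set s in para | (s.1.1.1 != s.1.1.2) && (s.1.1.1 != s.2.1.1)].

Lemma para_diff (s : I * I) : s \in para ->
  s.1.1.1%:Z - s.1.1.2%:Z = s.2.1.1%:Z - s.2.1.2%:Z.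
Proof.
case/collisionsP => _ _ /(congr1 fst).
by apply: diff_label_eq; rewrite -ltnS.
Qed.

Lemma para_quartic (s : I * I) : s \in para ->
  (fourth_gap s.1.1.1 s.1.1.2 s.2.1.1 s.2.1.2)%:~R = s.2.2 - s.1.2 :> 'F_p.
Proof.
case/collisionsP => _ _ /(congr1 snd); rewrite /= /quartic => e.
rewrite /fourth_gap !(rmorphB, rmorphD, rmorphXn) /=.
have -> : s.2.2 = s.1.1.1%:R ^+ 4 - s.1.1.2%:R ^+ 4 + s.1.2
    - (s.2.1.1%:R ^+ 4 - s.2.1.2%:R ^+ 4) by rewrite e; ring.
by rewrite -!pmulrn; ring.
Qed.

Lemma para_mem (s : I * I) : s \in para ->
  [/\ s.1.1.1 \in A, s.1.1.2 \in A, s.2.1.1 \in A, s.2.1.2 \in A & (s.1.2 \in Zs) /\ (s.2.2 \in Zs)].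
Proof.
have AIP t : t \in AI -> [/\ t.1.1 \in A, t.1.2 \in A & t.2 \in Zs].
  by rewrite inE => /and3P.
by case/collisionsP => /AIP[? ? ?] /AIP[? ? ?] _.
Qed.

(** If [x = y] then [x' = y'], if [x = x'] then [y = y'], and in both cases
    [n = n']; three free unknowns remain. *)
Lemma card_para : (#|para| <= 2 * (N ^ 2 * #|Zs|) + #|nondeg|)%N.
Proof.
pose P1 := [set s in para | s.1.1.1 == s.1.1.2].
pose P2 := [set s in para | s.1.1.1 == s.2.1.1].
have QU : (#|para| <= #|P1| + #|P2| + #|nondeg|)%N.
  have sub : para \subset P1 :|: P2 :|: nondeg.
    apply/fintype.subsetP => s sQ; rewrite !inE in sQ *; rewrite sQ /=.
    by case: (_ == _); case: (_ == _).
  apply: leq_trans (subset_leq_card sub) _.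
  apply: leq_trans (leq_card_setU _ _) _.
  by rewrite leq_add2r leq_card_setU.
have cX : (#|finset.setX (finset.setX A A) Zs| <= N ^ 2 * #|Zs|)%N.
  by rewrite !cardsX leq_mul2r -mulnn leq_mul ?card_le_bound ?orbT.
have b1 : (#|P1| <= N ^ 2 * #|Zs|)%N.
  apply: leq_trans cX.
  apply: (card_inj_on _ _ _ _ (fun s => (s.1.1.1, s.2.1.1, s.1.2))).
    by move=> s /setIdP[/para_mem[xA yA x'A y'A [nZ n'Z]] _]; rewrite !inE xA x'A.
  move=> [[[x y] n] [[x' y'] n']] [[[u v] m] [[u' v'] m']].
  move=> /setIdP[sQ /= /eqP xy] /setIdP[tQ /= /eqP uv] [e1 e2 e3]; subst u u' m y v.
  have := para_diff _ sQ; have := para_diff _ tQ => /= d1 d2.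
  have ? : v' = y' by apply: val_inj => /=; lia.
  have ? : y' = x' by apply: val_inj => /=; lia.
  subst v' y'.
  have := para_quartic _ sQ; have := para_quartic _ tQ => /=.
  by rewrite /fourth_gap !subrr sub0r addNr => /esym/subr0_eq -> /esym/subr0_eq ->.
have b2 : (#|P2| <= N ^ 2 * #|Zs|)%N.
  apply: leq_trans cX.
  apply: (card_inj_on _ _ _ _ (fun s => (s.1.1.1, s.1.1.2, s.1.2))).
    by move=> s /setIdP[/para_mem[xA yA x'A y'A [nZ n'Z]] _]; rewrite !inE xA yA.
  move=> [[[x y] n] [[x' y'] n']] [[[u v] m] [[u' v'] m']].
  move=> /setIdP[sQ /= /eqP xy] /setIdP[tQ /= /eqP uv] [e1 e2 e3]; subst u v m x' u'.
  have := para_diff _ sQ; have := para_diff _ tQ => /= d1 d2.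
  have ? : v' = y' by apply: val_inj => /=; lia.
  have ? : y' = y by apply: val_inj => /=; lia.
  subst v' y'.
  have := para_quartic _ sQ; have := para_quartic _ tQ => /=.
  by rewrite !fourth_gap_degenerate // => /esym/subr0_eq -> /esym/subr0_eq ->.
apply: leq_trans QU _; rewrite leq_add2r mul2n -addnn; exact: leq_add.
Qed.

(** Elements of [nondeg] of equal shape differ by a translation of the quadruple
    [(x, y, x', y')] and by the value of [n']. *)
Let shape (s : I * I) := (gap s.1, diff_label N s.1.1.1 s.2.1.1, s.1.2).
Let twins : {set (I * I) * (I * I)} := collisions nondeg shape.

Lemma twins_shape (r : (I * I) * (I * I)) : r \in twins ->
  [/\ r.1 \in nondeg, r.2 \in nondeg, r.1.1.2 = r.2.1.2,
    r.1.1.1.1%:Z - r.1.1.1.2%:Z = r.2.1.1.1%:Z - r.2.1.1.2%:Z &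
    r.1.1.1.1%:Z - r.1.2.1.1%:Z = r.2.1.1.1%:Z - r.2.2.1.1%:Z].
Proof.
case/collisionsP => r1 r2 e; have e1 := congr1 (fun u => u.1.1) e.
have e2 := congr1 (fun u => u.1.2) e; have e3 := congr1 (fun u => u.2) e.
by split=> //; [apply: diff_label_eq e1|apply: diff_label_eq e2]; rewrite -ltnS.
Qed.

Let third_diff (r : (I * I) * (I * I)) : int :=
  fourth_gap r.1.1.1.1 r.1.1.1.2 r.1.2.1.1 r.1.2.1.2
  - fourth_gap r.2.1.1.1 r.2.1.1.2 r.2.2.1.1 r.2.2.1.2.

Lemma third_diff_Fp (r : (I * I) * (I * I)) : r \in twins ->
  (third_diff r)%:~R = r.1.2.2 - r.2.2.2 :> 'F_p.
Proof.
case/twins_shape => /setIdP[r1 _] /setIdP[r2 _] e _ _.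
by rewrite /third_diff rmorphB /= (para_quartic _ r1) (para_quartic _ r2) e; ring.
Qed.

Lemma third_diff_prod (r : (I * I) * (I * I)) : r \in twins ->
  third_diff r = 12 * (r.1.1.1.1%:Z - r.1.1.1.2%:Z) * (r.1.1.1.1%:Z - r.1.2.1.1%:Z)
   * (r.1.1.1.1%:Z - r.2.1.1.1%:Z) * (r.1.1.1.1%:Z + r.2.2.1.2%:Z).
Proof.
case/twins_shape => /setIdP[r1 _] /setIdP[r2 _] e e1 e2; apply: third_difference => //.
- exact: (para_diff _ r1).
- exact: (para_diff _ r2).
Qed.

Lemma third_diff_bound (r : (I * I) * (I * I)) : (`|third_diff r| <= 4 * N ^ 4)%N.
Proof.
have b1 : (`|fourth_gap r.1.1.1.1 r.1.1.1.2 r.1.2.1.1 r.1.2.1.2| <= 2 * N ^ 4)%N.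
  by apply: fourth_gap_bound; rewrite -ltnS.
have b2 : (`|fourth_gap r.2.1.1.1 r.2.1.1.2 r.2.2.1.1 r.2.2.1.2| <= 2 * N ^ 4)%N.
  by apply: fourth_gap_bound; rewrite -ltnS.
rewrite /third_diff; move: b1 b2; set a := fourth_gap _ _ _ _; set b := fourth_gap _ _ _ _.
set c := (N ^ 4)%N; lia.
Qed.

(** When the two values of [n'] agree, the third difference vanishes; its factors
    [x - y] and [x - x'] and the sum of two positive integers do not, so the
    translation is trivial. *)
Lemma card_twins_diag : (#|[set r in twins | r.1.2.2 == r.2.2.2]| <= #|nondeg|)%N.
Proof.
apply: (card_inj_on _ _ _ _ fst).
  by move=> r /setIdP[/twins_shape[]].
suff H r : r \in [set r in twins | r.1.2.2 == r.2.2.2] -> r.2 = r.1.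
  by move=> [r1 r2] [q1 q2] /H/= -> /H/= -> ->.
case/setIdP => rE /eqP en.
have d0 : third_diff r = 0.
  apply: (@intr_Fp_eq0 p) => //; last by rewrite third_diff_Fp // en subrr.
  apply: leq_ltn_trans (third_diff_bound r) (leq_ltn_trans _ Np).
  by rewrite leq_mul2r orbT.
have := third_diff_prod _ rE; rewrite d0.
have [/setIdP[r1 /andP[n1 n2]] /setIdP[r2 _] e3 e1 e2] := twins_shape _ rE.
have xA : (0 < r.1.1.1.1)%N by case: (para_mem _ r1) => /mem_gt0.
have h1 := para_diff _ r1; have h2 := para_diff _ r2.
move=> /esym/third_difference_eq0 /(_ n1 n2 xA) e4.
move: e1 e2 e3 h1 h2 e4 en {xA rE d0 n1 n2 r1 r2}.
case: r => [[[[x y] n] [[x' y'] n']] [[[u v] m] [[u' v'] m']]] /= e1 e2 e3 h1 h2 e4 en.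
subst m n'; congr (_, _, _, (_, _, _)); apply: val_inj => /=; lia.
Qed.

(** When the two values of [n'] differ, they fix the nonzero value of the third
    difference.  The steps are divisors of it, and once they are known the
    remaining linear factor locates the quadruple. *)
Lemma card_twins_off : (#|[set r in twins | r.1.2.2 != r.2.2.2]| <= #|Zs| ^ 2 * D)%N.
Proof.
rewrite -mulnn -cardsX; apply: (card_fibre _ _ _ _ (fun r => (r.1.2.2, r.2.2.2))).
  move=> r /setIdP[/twins_shape[/setIdP[/para_mem[_ _ _ _ [_ z1]] _] /setIdP[/para_mem[_ _ _ _ [_ z2]] _] _ _ _] _].
  by rewrite finset.in_setX z1 z2.
move=> [n n'] _.
pose T : {set (I * I) * (I * I)} := [set r in [set r in twins | r.1.2.2 != r.2.2.2] | (r.1.2.2, r.2.2.2) == (n, n')].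
change (#|T| <= D)%N.
have [->|[r0 r0T]] := set_0Vmem T; first by rewrite cards0.
have TP r : r \in T -> [/\ r \in twins, r.1.2.2 = n, r.2.2.2 = n' & n != n'].
  by case/setIdP => /setIdP[rE ne] /eqP[e1 e2]; split=> //; rewrite -e1 -e2.
have [r0E r0n r0n' nn'] := TP _ r0T.
set m := third_diff r0.
have m0 : m != 0.
  apply/eqP => m0; have := third_diff_Fp _ r0E; rewrite -/m m0 r0n r0n' => /esym/subr0_eq/eqP.
  by rewrite (negPf nn').
have Tm r : r \in T -> third_diff r = m.
  case/TP => rE rn rn' _; apply: (@intr_Fp_inj p) => //; last first.
    by rewrite !third_diff_Fp // rn rn' r0n r0n'.
  have := third_diff_bound r; have := third_diff_bound r0; rewrite -/m.
  move: Np; set c := (N ^ 4)%N; lia.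
pose U : {set 'I_(2 * N).+1} := [set u : 'I_(2 * N).+1 | (`|(u : nat)%:Z - N%:Z|%N %| `|m|%N)%N].
apply: (@leq_trans #|finset.setX (finset.setX U U) U|); last first.
  rewrite !cardsX; apply: leq_trans (hD `|m| _); last first.
    by rewrite absz_gt0 m0 /= third_diff_bound.
  have hU : (#|U| <= 2 * size (divisors `|m|))%N by apply: card_diff_label_dvd; rewrite absz_gt0.
  by rewrite !expnS expn0 muln1 mulnA !leq_mul.
have diff_labelU (x y : nat) : (x <= N)%N -> (y <= N)%N -> (`|x%:Z - y%:Z| %| `|m|)%N -> diff_label N x y \in U.
  move=> xN yN; rewrite inE inordK; last by lia.
  by have -> : `|(x + N - y)%N%:Z - N|%N = `|x%:Z - y%:Z|%N by lia.
apply: (card_inj_on _ _ _ _ (fun r : (I * I) * (I * I) => (gap r.1.1, diff_label N r.1.1.1.1 r.1.2.1.1, diff_label N r.1.1.1.1 r.2.1.1.1))).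
  move=> r rT; have [rE _ _ _] := TP _ rT; have := Tm _ rT; rewrite third_diff_prod // => mE.
  have ordN (x : 'I_N.+1) : (x <= N)%N by rewrite -ltnS.
  rewrite !finset.in_setX !diff_labelU ?ordN // -mE !abszM.
  - by rewrite dvdn_mulr // dvdn_mull.
  - by rewrite dvdn_mulr // dvdn_mulr // dvdn_mull.
  - by rewrite dvdn_mulr // dvdn_mulr // dvdn_mulr // dvdn_mull.
move=> r s rT sT /= [f1 f2 f3].
have [rE rn rn' _] := TP _ rT; have [sE sn sn' _] := TP _ sT.
have {}f1 : r.1.1.1.1%:Z - r.1.1.1.2%:Z = s.1.1.1.1%:Z - s.1.1.1.2%:Z.
  by apply: diff_label_eq f1; rewrite -ltnS.
have {}f2 : r.1.1.1.1%:Z - r.1.2.1.1%:Z = s.1.1.1.1%:Z - s.1.2.1.1%:Z.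
  by apply: diff_label_eq f2; rewrite -ltnS.
have {}f3 : r.1.1.1.1%:Z - r.2.1.1.1%:Z = s.1.1.1.1%:Z - s.2.1.1.1%:Z.
  by apply: diff_label_eq f3; rewrite -ltnS.
have mr := Tm _ rT; have ms := Tm _ sT; rewrite !third_diff_prod // in mr ms.
have [/setIdP[r1 _] /setIdP[r2 _] re0 re1 re2] := twins_shape _ rE.
have [/setIdP[s1 _] /setIdP[s2 _] se0 se1 se2] := twins_shape _ sE.
have g1 := para_diff _ r1; have g2 := para_diff _ r2.
have g3 := para_diff _ s1; have g4 := para_diff _ s2.
have k1 := para_quartic _ r1; have k2 := para_quartic _ s1.
have sum_eq : r.1.1.1.1%:Z + r.2.2.1.2%:Z = s.1.1.1.1%:Z + s.2.2.1.2%:Z.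
  rewrite f1 f2 f3 in mr; rewrite -ms in mr.
  apply: mulfI mr; move: m0; rewrite -ms; apply: contraNneq => ->; by rewrite mul0r.
move: k1 k2 rn sn rn' sn' re0 se0 sum_eq f1 f2 f3 g1 g2 g3 g4 re1 re2 se1 se2; clear.
case: r => [[[[x y] n1] [[x' y'] n1']] [[[u v] m1] [[u' v'] m1']]].
case: s => [[[[a b] n2] [[a' b'] n2']] [[[c d] m2] [[c' d'] m2']]] /=.
move=> k1 k2 rn sn rn' sn' re0 se0 sum_eq f1 f2 f3 g1 g2 g3 g4 re1 re2 se1 se2.
have n1E : n1 = n - (fourth_gap x y x' y')%:~R by rewrite k1 rn; ring.
have n2E : n2 = n - (fourth_gap a b a' b')%:~R by rewrite k2 sn; ring.
clear k1 k2; subst n1' n2' m1' m2' m1 m2.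
have q1 : x = a by apply: val_inj => /=; clear n1E n2E; lia.
have q2 : y = b by apply: val_inj => /=; clear n1E n2E; lia.
have q3 : x' = a' by apply: val_inj => /=; clear n1E n2E; lia.
have q4 : y' = b' by apply: val_inj => /=; clear n1E n2E; lia.
have q5 : u = c by apply: val_inj => /=; clear n1E n2E; lia.
have q6 : v = d by apply: val_inj => /=; clear n1E n2E; lia.
have q7 : u' = c' by apply: val_inj => /=; clear n1E n2E; lia.
have q8 : v' = d' by apply: val_inj => /=; clear n1E n2E; lia.
by subst a b a' b' c d c' d'; rewrite n1E n2E.
Qed.

Lemma card_nondeg_sqr :
  (#|nondeg| ^ 2 <= (2 * N).+1 ^ 2 * #|Zs| * (#|nondeg| + #|Zs| ^ 2 * D))%N.
Proof.
have := @card_sqr_label _ _ nondeg (finset.setX [set: 'I_(2 * N).+1 * 'I_(2 * N).+1] Zs) shape.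
rewrite cardsX cardsT card_prod card_ord mulnn => /(_ _)/leq_trans; apply.
  by move=> s /setIdP[/para_mem[_ _ _ _ [nZ _]] _]; rewrite finset.in_setX nZ inE.
rewrite leq_mul2l; apply/orP; right; rewrite -/twins.
have -> : twins = [set r in twins | r.1.2.2 == r.2.2.2] :|: [set r in twins | r.1.2.2 != r.2.2.2].
  apply/finset.setP => r; rewrite finset.in_setU.
  apply/idP/orP => [rE|[]/setIdP[]//].
  by have [e|ne] := boolP (r.1.2.2 == r.2.2.2); [left|right]; apply/setIdP.
apply: leq_trans (leq_card_setU _ _) _.
by rewrite leq_add ?card_twins_diag ?card_twins_off.
Qed.

(** The bound [V = O (N ^ 3 * Z + N ^ 2 * (D * Z ^ 3) ^ (1 / 2))], as an
    alternative according to which of the two terms is the larger. *)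
Lemma quartic_collisions_bound : (0 < N)%N ->
  let V := #|collisions AI quartic| in
  (V <= 60 * N ^ 3 * #|Zs| \/ V ^ 2 <= 900 * N ^ 4 * D * #|Zs| ^ 3)%N.
Proof.
move=> N0 V.
have hV : (V <= 3 * N * (2 * (N ^ 2 * #|Zs|) + #|nondeg|))%N.
  have := @collisions_label _ 'I_(2 * N).+1 _ AI finset.setT quartic gap (fun _ _ => finset.in_setT _).
  move=> /leq_trans; apply; rewrite cardsT card_ord; apply: leq_mul; first by lia.
  exact: card_para.
have hS : (#|nondeg| ^ 2 <= 9 * N ^ 2 * #|Zs| * (#|nondeg| + #|Zs| ^ 2 * D))%N.
  apply: leq_trans card_nondeg_sqr _; rewrite leq_mul2r leq_mul2r; apply/orP; right.
  apply/orP; right; rewrite -[9%N]/(3 ^ 2)%N -expnMn leq_exp2r //; lia.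
move: hV hS; move: V #|nondeg| #|Zs| => V s z hV hS.
have [le|gt] := leqP s (18 * N ^ 2 * z).
  left; apply: leq_trans hV _.
  rewrite (_ : (60 * N ^ 3 * z = 3 * N * (20 * N ^ 2 * z))%N); last by ring.
  rewrite leq_mul2l; apply/orP; right; lia.
right.
have sD : (s <= z ^ 2 * D)%N.
  rewrite leqNgt; apply/negP => lt.
  have h : (s * s <= 9 * N ^ 2 * z * (2 * s))%N.
    by rewrite mulnn; apply: leq_trans hS _; rewrite leq_mul2l; apply/orP; right; lia.
  have : (s * s <= 18 * N ^ 2 * z * s)%N by apply: leq_trans h _; lia.
  rewrite leq_mul2r; lia.
have hS2 : (s ^ 2 <= 18 * N ^ 2 * z ^ 3 * D)%N.
  apply: leq_trans hS _.
  apply: (@leq_trans (9 * N ^ 2 * z * (2 * (z ^ 2 * D)))%N); last by lia.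
  by rewrite leq_mul2l; apply/orP; right; lia.
have hV2 : (V <= 6 * N * s)%N.
  apply: leq_trans hV _; rewrite (_ : (6 * N * s = 3 * N * (2 * s))%N); last by ring.
  rewrite leq_mul2l; apply/orP; right; lia.
apply: (@leq_trans ((6 * N * s) ^ 2)); first by rewrite leq_exp2r.
rewrite expnMn; apply: (@leq_trans ((6 * N) ^ 2 * (18 * N ^ 2 * z ^ 3 * D))%N).
  by rewrite leq_mul2l hS2 orbT.
rewrite (_ : (_ * _ = 648 * (N ^ 4 * D * z ^ 3))%N); last by ring.
by rewrite -!(mulnA 900%N) leq_mul2r orbT.
Qed.

End Quartic.

(** * Fourier analysis modulo a prime *)

Section Characters.
Variables (R : realType) (p : nat).
Hypothesis pp : prime p.

Definition cosp (z : 'F_p) : R := cos (2 * pi * (z : nat)%:R / p%:R).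
Definition sinp (z : 'F_p) : R := sin (2 * pi * (z : nat)%:R / p%:R).

Lemma p_neq0 : p%:R != 0 :> R.
Proof. by rewrite pnatr_eq0 -lt0n prime_gt0. Qed.

Lemma angle_mod (m : nat) :
  2 * pi * m%:R / p%:R = 2 * pi * (m %% p)%:R / p%:R + (pi *+ 2) *+ (m %/ p) :> R.
Proof.
rewrite {1}(divn_eq m p) natrD natrM -mulrnA -[pi *+ _]mulr_natr natrM.
by field; exact: p_neq0.
Qed.

Lemma cos_cosp (m : nat) : cos (2 * pi * m%:R / p%:R) = cosp m%:R.
Proof. by rewrite /cosp angle_mod (periodicn (@cosD2pi R)) val_Fp_nat. Qed.

Lemma sin_sinp (m : nat) : sin (2 * pi * m%:R / p%:R) = sinp m%:R.
Proof. by rewrite /sinp angle_mod (periodicn (@sinD2pi R)) val_Fp_nat. Qed.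

Lemma cospD y z : cosp (y + z) = cosp y * cosp z - sinp y * sinp z.
Proof.
rewrite -{1}(natr_Zp y) -{1}(natr_Zp z) -natrD -cos_cosp natrD mulrDr mulrDl cosD.
by [].
Qed.

Lemma sinpD y z : sinp (y + z) = sinp y * cosp z + cosp y * sinp z.
Proof.
by rewrite -{1}(natr_Zp y) -{1}(natr_Zp z) -natrD -sin_sinp natrD mulrDr mulrDl sinD.
Qed.

Lemma cosp0 : cosp 0 = 1. Proof. by rewrite /cosp mulr0 mul0r cos0. Qed.
Lemma sinp0 : sinp 0 = 0. Proof. by rewrite /sinp mulr0 mul0r sin0. Qed.

Lemma cosp2Dsinp2 z : cosp z ^+ 2 + sinp z ^+ 2 = 1.
Proof. exact: cos2Dsin2. Qed.

Lemma cosp_sinpN z : cosp (- z) = cosp z /\ sinp (- z) = - sinp z.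
Proof.
have h1 : cosp z * cosp (- z) - sinp z * sinp (- z) = 1 by rewrite -cospD subrr cosp0.
have h2 : sinp z * cosp (- z) + cosp z * sinp (- z) = 0 by rewrite -sinpD subrr sinp0.
have h3 := cosp2Dsinp2 z.
split.
  have -> : cosp (- z) = (cosp z ^+ 2 + sinp z ^+ 2) * cosp (- z) by rewrite h3 mul1r.
  rewrite -[RHS]mulr1 -[X in _ = _ * X]h1 -[LHS]addr0 -[X in _ + X](mulr0 (- sinp z)) -h2.
  ring.
have -> : sinp (- z) = (cosp z ^+ 2 + sinp z ^+ 2) * sinp (- z) by rewrite h3 mul1r.
rewrite -[RHS]mulr1 -[X in _ = _ * X]h1 -[LHS]addr0 -[X in _ + X](mulr0 (- cosp z)) -h2.
ring.
Qed.

Lemma cospN z : cosp (- z) = cosp z. Proof. by case: (cosp_sinpN z). Qed.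
Lemma sinpN z : sinp (- z) = - sinp z. Proof. by case: (cosp_sinpN z). Qed.

Lemma cospB y z : cosp (y - z) = cosp y * cosp z + sinp y * sinp z.
Proof. by rewrite cospD cospN sinpN; ring. Qed.

Lemma sum_oppFp (F : 'F_p -> R) : \sum_z F (- z) = \sum_z F z.
Proof. by rewrite [RHS](reindex_inj (@oppr_inj _)). Qed.

Lemma odd_sum0 (F : 'F_p -> R) : (forall z, F (- z) = - F z) -> \sum_z F z = 0.
Proof.
move=> h; have : \sum_z F z = - \sum_z F z.
  by rewrite -{1}sum_oppFp -sumrN; apply: eq_bigr.
by move/eqP; rewrite -addr_eq0 -mulr2n mulrn_eq0 => /eqP.
Qed.

Lemma cosp1_neq1 : cosp 1 != 1.
Proof.
have p2 : (2 <= p)%N := prime_gt1 pp.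
have piR : 0 < pi :> R := pi_gt0 R.
have p0 : 0 < p%:R :> R by rewrite ltr0n prime_gt0.
have i1 : 0 <= 2 * (pi : R) / p%:R <= pi.
  apply/andP; split.
    by apply: mulr_ge0; rewrite ?invr_ge0 ?(ltW p0) // mulr_ge0 // ltW.
  by rewrite ler_pdivrMr // mulrC ler_wpM2l ?(ltW piR) // ler_nat.
have := @cos_inj R (2 * pi / p%:R) 0; rewrite !in_itv /= lexx (ltW piR) i1 => /(_ isT isT) inj.
rewrite cos0 in inj; rewrite -[X in cosp X]/(1%:R) -cos_cosp mulr1; apply/eqP => /inj/eqP.
rewrite mulf_eq0 invr_eq0 (negPf p_neq0) orbF mulf_eq0.
by rewrite pnatr_eq0 /= gt_eqF.
Qed.

Lemma sum_cosp (n : 'F_p) : \sum_z cosp (n * z) = (n == 0)%:R * p%:R.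
Proof.
have [->|n0] := eqVneq n 0.
  under eq_bigr do rewrite mul0r cosp0.
  by rewrite sumr_const card_Fp // mul1r.
rewrite mul0r -(reindex_inj (mulfI n0) (P := xpredT) (F := cosp)) /=.
have S0 : \sum_z sinp z = 0 by apply: odd_sum0 => z; rewrite sinpN.
have : \sum_z cosp z = cosp 1 * \sum_z cosp z.
  transitivity (cosp 1 * (\sum_z cosp z) - sinp 1 * (\sum_z sinp z)); last by rewrite S0 mulr0 subr0.
  rewrite {1}(reindex_inj (addrI 1)) /= !mulr_sumr -sumrB.
  by apply: eq_bigr => z _; rewrite cospD.
move/eqP; rewrite -subr_eq0 -{1}(mul1r (\sum_z cosp z)) -mulrBl mulf_eq0 subr_eq0 eq_sym.
by rewrite (negPf cosp1_neq1) => /eqP.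
Qed.

Definition avg (F : 'F_p -> R) : R := p%:R^-1 * \sum_z F z.

Lemma avg_cosp n : avg (fun z => cosp (n * z)) = (n == 0)%:R.
Proof. by rewrite /avg sum_cosp mulrC mulfK // p_neq0. Qed.

Lemma avg_sum (I : finType) (P : pred I) (c : I -> R) (F : I -> 'F_p -> R) :
  avg (fun z => \sum_(i | P i) c i * F i z) = \sum_(i | P i) c i * avg (F i).
Proof.
rewrite /avg exchange_big mulr_sumr; apply: eq_bigr => i _.
by rewrite -mulr_sumr mulrCA.
Qed.

Lemma avg_ge0 F : (forall z, 0 <= F z) -> 0 <= avg F.
Proof. by move=> F0; rewrite mulr_ge0 ?invr_ge0 ?sumr_ge0. Qed.

Lemma ler_avg F G : (forall z, F z <= G z) -> avg F <= avg G.
Proof. by move=> h; rewrite ler_wpM2l ?invr_ge0 ?ler_sum. Qed.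

Lemma eq_avg F G : F =1 G -> avg F = avg G.
Proof. by move=> h; rewrite /avg (eq_bigr G). Qed.

Lemma avgZ c F : avg (fun z => c * F z) = c * avg F.
Proof. by rewrite /avg -mulr_sumr mulrCA. Qed.

Lemma avg_CauchySchwarz F G : avg (fun z => F z * G z) ^+ 2 <=
  avg (fun z => F z ^+ 2) * avg (fun z => G z ^+ 2).
Proof.
rewrite /avg exprMn [leRHS](_ : _ = p%:R^-1 ^+ 2 *
  ((\sum_z F z ^+ 2) * (\sum_z G z ^+ 2))); last by ring.
rewrite ler_wpM2l ?exprn_ge0 ?invr_ge0 //.
rewrite -(ler_pM2l (ltr0Sn R 1)).
have -> : (\sum_z F z * G z) ^+ 2 = \sum_y \sum_z (F y * G y) * (F z * G z).
  by rewrite expr2 mulr_suml; apply: eq_bigr => y _; rewrite mulr_sumr.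
have -> : 2 * ((\sum_z F z ^+ 2) * (\sum_z G z ^+ 2))
   = \sum_y \sum_z ((F y * G z) ^+ 2 + (F z * G y) ^+ 2).
  under [RHS]eq_bigr do rewrite big_split /=.
  rewrite big_split /= [X in _ + X]exchange_big /= mulr_natl mulr2n.
  congr (_ + _); rewrite mulr_suml; apply: eq_bigr => y _;
    by rewrite mulr_sumr; apply: eq_bigr => z _; rewrite exprMn.
rewrite mulr_sumr; apply: ler_sum => y _; rewrite mulr_sumr; apply: ler_sum => z _.
rewrite -subr_ge0; have -> : (F y * G z) ^+ 2 + (F z * G y) ^+ 2 - 2 * (F y * G y * (F z * G z)) = (F y * G z - F z * G y) ^+ 2 by ring.
exact: sqr_ge0.
Qed.

(** Adding the mean square of the companion sine sum turns the left side into the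
    mean of [|\sum_i s i * e (w i * z)| ^ 2], which orthogonality evaluates. *)
Lemma avg_sqr_cos_le (I : finType) (A : {set I}) (s : I -> R) (w : I -> 'F_p) :
  (forall i, `|s i| <= 1) ->
  avg (fun z => (\sum_(i in A) s i * cosp (w i * z)) ^+ 2) <= #|collisions A w|%:R.
Proof.
move=> s1.
apply: (@le_trans _ _ (avg (fun z => \sum_(ij in finset.setX A A)
    (s ij.1 * s ij.2) * cosp ((w ij.1 - w ij.2) * z)))).
  apply: ler_avg => z.
  have -> : \sum_(ij in finset.setX A A) (s ij.1 * s ij.2) * cosp ((w ij.1 - w ij.2) * z)
    = (\sum_(i in A) s i * cosp (w i * z)) ^+ 2 + (\sum_(i in A) s i * sinp (w i * z)) ^+ 2.
    rewrite !expr2 !big_distrlr /= -big_split /=.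
    under [RHS]eq_bigr do rewrite -big_split /=.
    rewrite pair_big_dep /=; apply: eq_big => [[i j]|[i j] _] /=; first by rewrite finset.in_setX.
    by rewrite mulrBl cospB; ring.
  by rewrite lerDl sqr_ge0.
rewrite avg_sum -sum1_card natr_sum.
rewrite [leLHS](eq_bigl (fun ij => (ij.1 \in A) && (ij.2 \in A))); last first.
  by case=> i j; rewrite finset.in_setX.
rewrite [leRHS](eq_bigl (fun ij => ((ij.1 \in A) && (ij.2 \in A)) && (w ij.1 == w ij.2))); last first.
  by move=> ij; rewrite inE andbA.
rewrite [leRHS]big_mkcondr /=; apply: ler_sum => ij _.
rewrite avg_cosp subr_eq0; case: eqP => _; last by rewrite mulr0.
rewrite mulr1; apply: le_trans (ler_norm _) _; rewrite normrM.
by rewrite -[leRHS]mulr1 ler_pM.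
Qed.

(** For even [F] this is the usual Fourier coefficient, the sine part being zero. *)
Definition coef (F : 'F_p -> R) (n : 'F_p) : R := avg (fun z => F z * cosp (n * z)).

Section Even.
Variable F : 'F_p -> R.
Hypothesis Feven : forall z, F (- z) = F z.

Lemma avg_even_sin (n : 'F_p) : \sum_z F z * sinp (n * z) = 0.
Proof. by apply: odd_sum0 => z; rewrite mulrN sinpN Feven mulrN. Qed.

(** The sine sum of an even function vanishes, so shifting the argument of the
    cosine only multiplies the sum by a cosine.  This plays the part of the
    multiplicativity of complex characters. *)
Lemma sum_even_shift (n t : 'F_p) :
  \sum_z F z * cosp (n * z + t) = (\sum_z F z * cosp (n * z)) * cosp t.
Proof.
transitivity ((\sum_z F z * cosp (n * z)) * cosp t - (\sum_z F z * sinp (n * z)) * sinp t).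
  rewrite !mulr_suml -sumrB; apply: eq_bigr => z _; rewrite cospD; ring.
by rewrite avg_even_sin mul0r subr0.
Qed.

End Even.

Lemma Parseval F : (forall z, F (- z) = F z) ->
  \sum_n coef F n ^+ 2 = avg (fun z => F z ^+ 2).
Proof.
move=> Fe.
have h n : coef F n ^+ 2 = p%:R^-1 ^+ 2 * \sum_y \sum_z F y * F z * cosp ((z + y) * n).
  rewrite /coef /avg exprMn; congr (_ * _).
  rewrite expr2 mulr_suml; apply: eq_bigr => y _.
  rewrite -mulrA (mulrC (cosp _)) -sum_even_shift // mulr_sumr.
  by apply: eq_bigr => z _; rewrite mulrA mulrDl !(mulrC n).
under eq_bigr do rewrite h.
rewrite -mulr_sumr exchange_big /= expr2 -mulrA; congr (_ * _).
rewrite mulr_sumr; apply: eq_bigr => y _.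
rewrite exchange_big /= (bigD1 (- y)) //= [X in _ * (_ + X)]big1 ?addr0; last first.
  move=> z zy; rewrite -mulr_sumr sum_cosp addr_eq0 (negPf zy) mul0r mulr0 //.
rewrite -mulr_sumr sum_cosp addNr eqxx mul1r mulrCA mulVf ?p_neq0 // mulr1 Fe expr2 //.
Qed.

(** Expanding the three coefficients leaves [p] times the indicator function of
    [x + u * y + v * z = 0], and [F] is even. *)
Lemma trilinear F (u v : 'F_p) : (forall z, F (- z) = F z) ->
  p%:R^-1 ^+ 2 * \sum_y \sum_z F y * F z * F (u * y + v * z)
   = \sum_n coef F n * coef F (u * n) * coef F (v * n).
Proof.
move=> Fe.
have h n : coef F n * coef F (u * n) * coef F (v * n) =
   p%:R^-1 ^+ 3 * \sum_y \sum_z \sum_x F y * F z * F x * cosp ((x + (u * y + v * z)) * n).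
  rewrite /coef /avg.
  have -> (a b c d : R) : (a * b) * (a * c) * (a * d) = a ^+ 3 * (b * (d * c)) by ring.
  congr (_ * _).
  have -> : (\sum_z F z * cosp (v * n * z)) * (\sum_y F y * cosp (u * n * y))
     = \sum_y \sum_z F y * (F z * cosp (v * n * z + u * n * y)).
    rewrite mulr_sumr; apply: eq_bigr => y _.
    by rewrite mulrCA -sum_even_shift // mulr_sumr.
  rewrite mulr_sumr; apply: eq_bigr => y _; rewrite mulr_sumr; apply: eq_bigr => z _.
  rewrite mulrC -!mulrA (mulrC (cosp _)) -sum_even_shift // !mulr_sumr.
  apply: eq_bigr => x _; rewrite !mulrA; congr (_ * cosp _); ring.
have -> : \sum_y \sum_z F y * F z * F (u * y + v * z) =
   p%:R^-1 * \sum_n \sum_y \sum_z \sum_x F y * F z * F x * cosp ((x + (u * y + v * z)) * n).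
  rewrite [in RHS]exchange_big /= mulr_sumr; apply: eq_bigr => y _.
  rewrite [in RHS]exchange_big /= mulr_sumr; apply: eq_bigr => z _.
  rewrite [in RHS]exchange_big /= [in RHS](bigD1 (- (u * y + v * z))) //= [X in _ * (_ + X)]big1 ?addr0; last first.
    move=> x ne; rewrite -addr_eq0 in ne.
    by rewrite -mulr_sumr sum_cosp (negPf ne) mul0r mulr0.
  by rewrite -mulr_sumr sum_cosp addNr eqxx mul1r Fe; field; exact: p_neq0.
rewrite mulrA -exprSr mulr_sumr; apply: eq_bigr => n _; exact/esym/h.
Qed.

End Characters.

(** * The cubic moment of the Fourier coefficients *)

(** Here [f] stands for [|h|] at the points [z / p], for a set [A] of integers of
    [1, N]. *)
Section Core.
Variables (R : realType) (p N : nat) (A : {set 'I_N.+1}) (D : nat) (f : 'F_p -> R).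
Hypothesis pp : prime p.
Hypothesis N0 : (0 < N)%N.
Hypothesis A0 : ord0 \notin A.
Hypothesis Np : (8 * N ^ 4 < p)%N.
Hypothesis hD : forall m, (0 < m <= 4 * N ^ 4)%N -> ((2 * size (divisors m)) ^ 3 <= D)%N.
Hypothesis f_ge0 : forall z, 0 <= f z.
Hypothesis f_sqr : forall z, f z ^+ 2 =
  \sum_(x in A) \sum_(y in A) cosp R p ((x%:R ^+ 4 - y%:R ^+ 4) * z).

Notation C := (cosp R p).
Notation S := (sinp R p).
Notation av := (avg R p).
Notation ps := (coef R p (fun z => f z ^+ 7)).

Lemma f_even z : f (- z) = f z.
Proof.
apply/eqP; rewrite -(@eqrXn2 _ 2) //; apply/eqP; rewrite !f_sqr.
by apply: eq_bigr => x _; apply: eq_bigr => y _; rewrite mulrN cospN.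
Qed.

Lemma f_le_bound z : f z <= N%:R.
Proof.
rewrite -(@ler_pXn2r _ 2) ?nnegrE // f_sqr.
apply: (@le_trans _ _ (\sum_(x in A) \sum_(y in A) 1)).
  by apply: ler_sum => x _; apply: ler_sum => y _; exact: cos_le1.
rewrite !sumr_const -mulrnA -natrX ler_nat -mulnn.
by rewrite leq_mul // card_le_bound.
Qed.

Lemma avg14_le : av (fun z => f z ^+ 14) <= N%:R ^+ 2 * av (fun z => f z ^+ 12).
Proof.
rewrite -avgZ; apply: ler_avg => z; rewrite (exprD _ 2 12) ler_wpM2r ?exprn_ge0 //.
by rewrite lerXn2r ?nnegrE // f_le_bound.
Qed.

Lemma coef_le n : `|ps n| <= av (fun z => f z ^+ 7).
Proof.
rewrite /coef /avg normrM ger0_norm ?invr_ge0 //; apply: ler_wpM2l; first by rewrite invr_ge0.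
apply: le_trans (ler_norm_sum _ _ _) _; apply: ler_sum => z _.
rewrite normrM ger0_norm ?exprn_ge0 // -[leRHS]mulr1.
by rewrite ler_wpM2l ?exprn_ge0 //; exact: cos_max.
Qed.

Section Twist.
Variables (Zs : {set 'F_p}) (s : 'F_p -> R).
Hypothesis s1 : forall n, `|s n| <= 1.

Let k z := \sum_(n in Zs) s n * C (n * z).
Let AI : {set 'I_N.+1 * 'I_N.+1 * 'F_p} :=
  [set t | [&& t.1.1 \in A, t.1.2 \in A & t.2 \in Zs]].
Let V := #|collisions AI quartic|.

(** The double sine sum over [A] vanishes by symmetry, so [f ^ 2 * k] is a single
    cosine sum with frequencies [x ^ 4 - y ^ 4 + n]. *)
Lemma sqr_mul_twist z : f z ^+ 2 * k z = \sum_(t in AI) s t.2 * C (quartic t * z).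
Proof.
have S0 : \sum_(x in A) \sum_(y in A) S ((x%:R ^+ 4 - y%:R ^+ 4) * z) = 0.
  set X := (X in X = 0).
  have : X = - X.
    rewrite {1}/X exchange_big /= -sumrN; apply: eq_bigr => x _.
    by rewrite -sumrN; apply: eq_bigr => y _; rewrite -opprB mulNr sinpN.
  by move/eqP; rewrite -addr_eq0 -mulr2n mulrn_eq0 => /eqP.
have -> : f z ^+ 2 * k z = \sum_(n in Zs) s n *
   \sum_(x in A) \sum_(y in A) C ((x%:R ^+ 4 - y%:R ^+ 4 + n) * z).
  rewrite /k mulr_sumr; apply: eq_bigr => n _; rewrite mulrCA; congr (_ * _).
  transitivity ((\sum_(x in A) \sum_(y in A) C ((x%:R ^+ 4 - y%:R ^+ 4) * z)) * C (n * z) -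
    (\sum_(x in A) \sum_(y in A) S ((x%:R ^+ 4 - y%:R ^+ 4) * z)) * S (n * z)).
    by rewrite S0 mul0r subr0 f_sqr.
  rewrite !mulr_suml -sumrB; apply: eq_bigr => x _.
  rewrite !mulr_suml -sumrB; apply: eq_bigr => y _.
  by rewrite -cospD // -mulrDl.
rewrite [RHS](eq_bigl (fun t => ((t.1.1 \in A) && (t.1.2 \in A)) && (t.2 \in Zs))); last first.
  by move=> t; rewrite inE andbA.
rewrite /quartic.
rewrite -(pair_big_dep (fun u => (u.1 \in A) && (u.2 \in A)) (fun _ n => n \in Zs)
  (fun u n => s n * C ((u.1%:R ^+ 4 - u.2%:R ^+ 4 + n) * z))) /= exchange_big /=.
apply: eq_bigr => n _; rewrite mulr_sumr.
rewrite -(pair_big_dep (fun x => x \in A) (fun _ y => y \in A)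
  (fun x y => s n * C ((x%:R ^+ 4 - y%:R ^+ 4 + n) * z))) /=.
by apply: eq_bigr => x _; rewrite mulr_sumr.
Qed.

Lemma avg_f4k2 : av (fun z => (f z ^+ 2 * k z) ^+ 2) <= V%:R.
Proof.
rewrite (eq_avg _ _ _ (fun z => (\sum_(t in AI) s t.2 * C (quartic t * z)) ^+ 2)); last first.
  by move=> z; rewrite sqr_mul_twist.
exact: avg_sqr_cos_le.
Qed.

Lemma avg_k2 : av (fun z => k z ^+ 2) <= #|Zs|%:R.
Proof.
apply: le_trans (avg_sqr_cos_le _ _ pp _ Zs s id s1) _; rewrite ler_nat.
apply: (card_inj_on _ _ _ _ fst); first by move=> ij /collisionsP[].
by move=> [i j] [i' j'] /collisionsP[_ _ /= <-] /collisionsP[_ _ /= <-] ->.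
Qed.

Let X := av (fun z => f z ^+ 7 * k z).

(** Split [f ^ 7 * k] as [f ^ 5 * (f ^ 2 * k)] for the first bound.  For the
    second, multiply the first by the square of the bound obtained from
    [f ^ 6 * (f * k)], where the mean square [Y] of [f * k] is in turn estimated
    by splitting its square as [(f ^ 2 * k) * k]. *)
Lemma twist_bounds :
  X ^+ 2 <= av (fun z => f z ^+ 10) * V%:R /\
  X ^+ 6 <= av (fun z => f z ^+ 10) * av (fun z => f z ^+ 12) ^+ 2 * (V%:R ^+ 2 * #|Zs|%:R).
Proof.
have A10 : 0 <= av (fun z => f z ^+ 10) by apply: avg_ge0 => z; rewrite exprn_ge0.
have A12 : 0 <= av (fun z => f z ^+ 12) by apply: avg_ge0 => z; rewrite exprn_ge0.
have h1 : X ^+ 2 <= av (fun z => f z ^+ 10) * V%:R.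
  rewrite /X (eq_avg _ _ _ (fun z => f z ^+ 5 * (f z ^+ 2 * k z))); last by move=> z; ring.
  apply: le_trans (avg_CauchySchwarz _ _ _ _) _.
  rewrite (eq_avg _ _ _ (fun z => f z ^+ 10)); last by move=> z; rewrite -exprM.
  by rewrite ler_wpM2l // avg_f4k2.
set Y := av (fun z => (f z * k z) ^+ 2).
have Y0 : 0 <= Y by apply: avg_ge0 => z; rewrite sqr_ge0.
have h2 : X ^+ 2 <= av (fun z => f z ^+ 12) * Y.
  rewrite /X (eq_avg _ _ _ (fun z => f z ^+ 6 * (f z * k z))); last by move=> z; ring.
  apply: le_trans (avg_CauchySchwarz _ _ _ _) _.
  by rewrite (eq_avg _ _ _ (fun z => f z ^+ 12)) // => z; rewrite -exprM.
have h3 : Y ^+ 2 <= V%:R * #|Zs|%:R.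
  rewrite /Y (eq_avg _ _ _ (fun z => (f z ^+ 2 * k z) * k z)); last by move=> z; ring.
  apply: le_trans (avg_CauchySchwarz _ _ _ _) _.
  apply: ler_pM; [by apply: avg_ge0 => z; exact: sqr_ge0..| exact: avg_f4k2|exact: avg_k2].
split=> //.
rewrite (_ : X ^+ 6 = X ^+ 2 * (X ^+ 2) ^+ 2); last by ring.
rewrite [leRHS](_ : _ = (av (fun z => f z ^+ 10) * V%:R) *
  (av (fun z => f z ^+ 12) ^+ 2 * (V%:R * #|Zs|%:R))); last by ring.
apply: ler_pM; rewrite ?sqr_ge0 //.
apply: (@le_trans _ _ ((av (fun z => f z ^+ 12) * Y) ^+ 2)).
  by apply: lerXn2r => //; rewrite nnegrE; [exact: sqr_ge0|exact: mulr_ge0].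
by rewrite exprMn ler_wpM2l ?sqr_ge0.
Qed.
End Twist.

(** Apply [twist_bounds] to the signs of the coefficients of size at least [T];
    the two cases are those of [quartic_collisions_bound]. *)
Lemma large_values (T : R) : 0 < T ->
  let z : R := #|[set n | T <= `|ps n|]|%:R in
  T ^+ 2 * z <= 60 * N%:R ^+ 3 * av (fun z => f z ^+ 10) \/
  T ^+ 6 * z ^+ 2 <= 900 * N%:R ^+ 4 * D%:R *
     (av (fun z => f z ^+ 10) * av (fun z => f z ^+ 12) ^+ 2).
Proof.
move=> T0 z.
have A10 : 0 <= av (fun z => f z ^+ 10) by apply: avg_ge0 => y; rewrite exprn_ge0.
have A12 : 0 <= av (fun z => f z ^+ 12) by apply: avg_ge0 => y; rewrite exprn_ge0.
set Zs := [set n | T <= `|ps n|] in z *.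
have [z0|] := eqVneq z 0.
  by left; rewrite z0 mulr0; apply: mulr_ge0 => //; rewrite mulr_ge0 // exprn_ge0.
rewrite -normr_gt0 ger0_norm ?ler0n // => z0.
pose s n : R := Num.sg (ps n).
have s1 n : `|s n| <= 1 by rewrite /s normr_sg; case: (_ == _); rewrite ?ler01 ?lexx.
have [h1 h2] := twist_bounds Zs s s1.
set X := av _ in h1 h2; move: h1 h2; set V := #|collisions _ _| => h1 h2.
have TX : T * z <= X.
  have -> : X = \sum_(n in Zs) s n * ps n.
    rewrite /X /coef -avg_sum; apply: eq_avg => y; rewrite mulr_sumr.
    by apply: eq_bigr => n _; rewrite mulrCA.
  rewrite mulrC -[z]/(#|Zs|%:R) mulr_natl -sumr_const; apply: ler_sum => n.
  by rewrite inE => /le_trans; apply; rewrite /s -normrEsg.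
have TX0 : 0 <= T * z by rewrite mulr_ge0 // ltW.
have := quartic_collisions_bound p N A Zs D pp A0 Np hD N0; rewrite /= -/V => -[hV|hV].
  left; rewrite -(ler_pM2r z0).
  have : (T * z) ^+ 2 <= av (fun z => f z ^+ 10) * (60 * N%:R ^+ 3 * z).
    apply: le_trans (le_trans h1 _); first by rewrite lerXn2r ?nnegrE // (le_trans TX0).
    by rewrite ler_wpM2l // -natrX -!natrM ler_nat.
  by congr (_ <= _); ring.
right; rewrite -(ler_pM2r (exprn_gt0 4 z0)).
have : (T * z) ^+ 6 <= av (fun z => f z ^+ 10) * av (fun z => f z ^+ 12) ^+ 2 *
   (900 * N%:R ^+ 4 * D%:R * z ^+ 3 * z).
  apply: le_trans (le_trans h2 _); first by rewrite lerXn2r ?nnegrE // (le_trans TX0).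
  apply: ler_wpM2l; first by rewrite mulr_ge0 ?sqr_ge0.
  apply: ler_wpM2r; first exact: ltW.
  by rewrite -!natrX -!natrM ler_nat.
by congr (_ <= _); ring.
Qed.

(** A value above [T] lies in one of the intervals
    [[T * rho ^ i, T * rho ^ i.+1]]. *)
Lemma layer_cake (x T rho : R) (L : nat) : 0 <= x -> 0 < T -> 1 <= rho -> x <= T * rho ^+ L ->
  x ^+ 3 <= T * x ^+ 2 + \sum_(i < L) (T * rho ^+ i <= x)%R%:R * (T * rho ^+ i.+1) ^+ 3.
Proof.
move=> x0 T0 r1; have r0 : 0 <= rho by apply: le_trans r1.
have t0 i : 0 <= (T * rho ^+ i) ^+ 3 by rewrite exprn_ge0 // mulr_ge0 ?exprn_ge0 // ltW.
elim: L => [|L IH].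
  by rewrite expr0 mulr1 big_ord0 addr0 exprS => xT; rewrite ler_wpM2r ?sqr_ge0.
move=> xT; rewrite big_ord_recr /=.
have [le|/ltW le] := lerP x (T * rho ^+ L).
  by apply: le_trans (IH le) _; rewrite addrA lerDl mulr_ge0.
rewrite le mul1r; apply: (@le_trans _ _ ((T * rho ^+ L.+1) ^+ 3)).
  by rewrite lerXn2r ?nnegrE // (le_trans x0).
rewrite addrA lerDr addr_ge0 ?mulr_ge0 ?sqr_ge0 ?(ltW T0) ?sumr_ge0 // => i _.
by rewrite mulr_ge0.
Qed.

(** [W] is a bound, uniform in the level, for the cube of the level times the number
    of coefficients reaching it. *)
Lemma cubic_moment (T rho W : R) (L : nat) : 0 < T -> 1 <= rho -> 0 <= W ->
  av (fun z => f z ^+ 7) <= T * rho ^+ L ->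
  60 * N%:R ^+ 3 * av (fun z => f z ^+ 7) * av (fun z => f z ^+ 10) <= W ->
  900 * N%:R ^+ 4 * D%:R * (av (fun z => f z ^+ 10) * av (fun z => f z ^+ 12) ^+ 2) <= W ^+ 2 ->
  \sum_n `|ps n| ^+ 3 <= T * (N%:R ^+ 2 * av (fun z => f z ^+ 12)) + L%:R * rho ^+ 3 * W.
Proof.
move=> T0 r1 W0 hT hW1 hW2.
have r0 : 0 <= rho by apply: le_trans r1.
have A10 : 0 <= av (fun z => f z ^+ 10) by apply: avg_ge0 => y; rewrite exprn_ge0.
apply: le_trans (ler_sum _ (fun n _ => layer_cake _ T rho L (normr_ge0 _) T0 r1 (le_trans (coef_le n) hT))) _.
rewrite big_split /= -mulr_sumr; apply: lerD.
  rewrite ler_wpM2l ?(ltW T0) //; apply: le_trans avg14_le.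
  under eq_bigr do rewrite real_normK ?num_real //.
  rewrite Parseval //; last by move=> z; rewrite f_even.
  by apply: ler_avg => z; rewrite -exprM.
rewrite exchange_big /= -mulrA mulr_natl -[X in _ *+ X](card_ord L) -sumr_const.
apply: ler_sum => i _.
set Ti := T * rho ^+ i.
have Ti0 : 0 < Ti by rewrite mulr_gt0 // exprn_gt0 // (lt_le_trans ltr01).
have -> : \sum_n (Ti <= `|ps n|)%R%:R * (T * rho ^+ i.+1) ^+ 3 =
  rho ^+ 3 * (Ti ^+ 3 * #|[set n | Ti <= `|ps n|]|%:R).
  rewrite -mulr_suml -natr_sum -sum1_card big_mkcond /= [in RHS]big_mkcond /=.
  rewrite (eq_bigr (fun n : 'F_p => if n \in [set n : 'F_p | (Ti <= `|ps n|)%R] then 1 else 0)%N); last first.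
    by move=> n _; rewrite inE; case: (_ <= _).
  rewrite /Ti (exprSr rho i); set c := (\sum_n _)%:R; ring.
apply: ler_wpM2l; first by rewrite exprn_ge0.
set z : R := #|_|%:R.
have z0 : 0 <= z by rewrite ler0n.
have [h|h] := large_values Ti Ti0; rewrite -/z in h.
  have [zz|zz] := eqVneq z 0; first by rewrite zz mulr0.
  have TA : Ti <= av (fun z => f z ^+ 7).
    have : [set n | Ti <= `|ps n|] != finset.set0.
      by apply: contraNneq zz => e; rewrite /z e cards0.
    by case/set0Pn => n; rewrite inE => /le_trans; apply; exact: coef_le.
  apply: le_trans hW1; rewrite exprS -mulrA.
  apply: (@le_trans _ _ (av (fun z => f z ^+ 7) * (60 * N%:R ^+ 3 * av (fun z => f z ^+ 10)))).
    by apply: ler_pM => //; [rewrite ltW|rewrite mulr_ge0 ?sqr_ge0].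
  by rewrite le_eqVlt; apply/orP; left; apply/eqP; ring.
rewrite -(@ler_pXn2r _ 2) ?nnegrE ?mulr_ge0 ?exprn_ge0 ?(ltW T0) //.
apply: le_trans hW2; apply: le_trans h.
by rewrite le_eqVlt; apply/orP; left; apply/eqP; ring.
Qed.

Lemma prod3_le (x y z : R) : x * y * z <= 3^-1 * (`|x| ^+ 3 + `|y| ^+ 3 + `|z| ^+ 3).
Proof.
apply: le_trans (ler_norm _) _; rewrite !normrM.
move: (normr_ge0 x) (normr_ge0 y) (normr_ge0 z).
move: `|x| `|y| `|z| => {}x {}y {}z x0 y0 z0.
have : 0 <= (x + y + z) * ((x - y) ^+ 2 + (y - z) ^+ 2 + (z - x) ^+ 2).
  by rewrite mulr_ge0 ?addr_ge0 ?sqr_ge0.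
nra.
Qed.

(** The substitution [y = a * j], [z = b * k] brings the sum into the form of
    [trilinear]; then the inequality of arithmetic and geometric means applies, as
    multiplication by a unit permutes the frequencies. *)
Lemma entangled_discrete (a b c d : 'F_p) : a != 0 -> b != 0 -> c != 0 -> d != 0 ->
  p%:R^-1 ^+ 2 * (\sum_j \sum_k f (a * j) ^+ 7 * f (b * k) ^+ 7 * f (c * j + d * k) ^+ 7)
   <= \sum_n `|ps n| ^+ 3.
Proof.
move=> a0 b0 c0 d0.
have -> : \sum_j \sum_k f (a * j) ^+ 7 * f (b * k) ^+ 7 * f (c * j + d * k) ^+ 7 =
  \sum_y \sum_z f y ^+ 7 * f z ^+ 7 * f (c / a * y + d / b * z) ^+ 7.
  rewrite [RHS](reindex_inj (mulfI a0)) /=; apply: eq_bigr => j _.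
  rewrite [RHS](reindex_inj (mulfI b0)) /=; apply: eq_bigr => k _.
  by rewrite !mulrA !mulfVK.
rewrite (trilinear R p pp (fun z => f z ^+ 7)); last by move=> z; rewrite f_even.
apply: le_trans (ler_sum _ (fun n _ => prod3_le _ _ _)) _.
rewrite -mulr_sumr !big_split /=.
have re (u : 'F_p) : u != 0 -> \sum_n `|ps (u * n)| ^+ 3 = \sum_n `|ps n| ^+ 3.
  by move=> u0; rewrite [RHS](reindex_inj (mulfI u0)).
rewrite (re (c / a)); last by rewrite mulf_neq0 ?invr_eq0.
rewrite (re (d / b)); last by rewrite mulf_neq0 ?invr_eq0.
by rewrite le_eqVlt; apply/orP; left; apply/eqP; field.
Qed.

End Core.

(** * Riemann sums of Lipschitz functions *)

Section Riemann.
Variable R : realType.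
Notation mu := (@lebesgue_measure R).

Definition lipschitz (M : R) (g : R -> R) := forall x y, `|g x - g y| <= M * `|x - y|.

Lemma lipschitz_ge0 M g : lipschitz M g -> 0 <= M.
Proof.
by move=> /(_ 1 0); rewrite subr0 normr1 mulr1; apply: le_trans.
Qed.

Lemma lipschitz_continuous M g : lipschitz M g -> continuous g.
Proof.
move=> gM x; apply/cvgrPdist_le => /= eps eps0.
have M0 := lipschitz_ge0 _ _ gM.
have M1 : 0 < M + 1 by rewrite ltr_wpDl.
near=> y; apply: le_trans (gM _ _) _.
apply: (@le_trans _ _ ((M + 1) * (eps / (M + 1)))); last by rewrite mulrC divfK ?gt_eqF.
apply: ler_pM => //; first by rewrite lerDl.
near: y; apply: cvgr_dist_le; [exact: cvg_id|by rewrite divr_gt0].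
Unshelve. all: by end_near. Qed.

Lemma lipschitz_integrable M g a b : lipschitz M g -> mu.-integrable `[a, b]%classic (EFin \o g).
Proof.
move=> gM; apply: continuous_compact_integrable; first exact: segment_compact.
by apply: continuous_subspaceT => x; apply: lipschitz_continuous gM _.
Qed.

Lemma Rintegral_itv_near g M (a b c e : R) : lipschitz M g -> a <= b ->
  (forall x, a < x <= b -> `|g x - c| <= e) ->
  `|\int[mu]_(x in `]a, b]) g x - c * (b - a)| <= e * (b - a).
Proof.
move=> gM ab gc.
have ig : mu.-integrable `]a, b]%classic (EFin \o g).
  by apply: integrableS (lipschitz_integrable _ _ a b gM) => //; exact: subset_itv_oc_cc.
have ic r : mu.-integrable `]a, b]%classic (EFin \o (fun=> r)).
  apply: integrableS (_ : mu.-integrable `[a, b]%classic _) => //.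
    exact: subset_itv_oc_cc.
  by apply: (@lipschitz_integrable 0) => x y; rewrite subrr normr0 mul0r.
have cst r : \int[mu]_(x in `]a, b]) r = r * (b - a).
  rewrite Rintegral_cst //; congr (_ * _).
  rewrite [X in fine X](lebesgue_measure_itv `]a, b]) /= lte_fin.
  by case: ltP => //= ba; apply/eqP; rewrite eq_sym subr_eq0 eq_le ba ab.
rewrite ler_distl; apply/andP; split.
  rewrite -mulrBl -cst; apply: le_Rintegral => // x /=; rewrite in_itv /= => /gc.
  by rewrite ler_distl => /andP[].
rewrite -mulrDl -cst; apply: le_Rintegral => // x /=; rewrite in_itv /= => /gc.
by rewrite ler_distl => /andP[].
Qed.

(** By induction on the number of cells, each contributing at most
    [M / n ^ 2] to the error. *)
Lemma riemann_sum g M (n : nat) : lipschitz M g -> (0 < n)%N ->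
  `|\int[mu]_(x in `[0, 1]) g x - n%:R^-1 * \sum_(i < n) g (i%:R / n%:R)| <= M / n%:R.
Proof.
move=> gM n0.
have nR : 0 < n%:R :> R by rewrite ltr0n.
have M0 := lipschitz_ge0 _ _ gM.
suff H k : `|\int[mu]_(x in `[0, k%:R / n%:R]) g x
    - n%:R^-1 * \sum_(i < k) g (i%:R / n%:R)| <= k%:R * (M / n%:R / n%:R).
  have nn0 : n%:R != 0 :> R by rewrite gt_eqF.
  by have := H n; rewrite mulfV // (_ : n%:R * (M / n%:R / n%:R) = M / n%:R) //; field.
elim: k => [|k IH].
  by rewrite big_ord0 !mul0r mulr0 subr0 set_itv1 Rintegral_set1 normr0.
have kk : k%:R / n%:R <= k.+1%:R / n%:R :> R by rewrite ler_pM2r ?invr_gt0 // ler_nat.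
have k0 : 0 <= k%:R / n%:R :> R by rewrite divr_ge0.
have := @Rintegral_itvB _ g (BLeft 0) (BRight (k.+1%:R / n%:R)) (k%:R / n%:R)
  (lipschitz_integrable _ _ _ _ gM).
rewrite !bnd_simp => /(_ k0 kk) e.
have dk : k.+1%:R / n%:R - k%:R / n%:R = n%:R^-1 :> R.
  by rewrite -mulrBl -natrB // subSnn mul1r.
have := Rintegral_itv_near g M (k%:R / n%:R) (k.+1%:R / n%:R) (g (k%:R / n%:R)) (M / n%:R) gM kk.
rewrite -e dk => step.
have {}step : `|\int[mu]_(x in `[0, (k.+1%:R / n%:R)]) g x -
   \int[mu]_(x in `[0, (k%:R / n%:R)]) g x - g (k%:R / n%:R) * n%:R^-1| <= M / n%:R / n%:R.
  apply: step => x /andP[x1 x2]; apply: le_trans (gM _ _) _.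
  rewrite ler_wpM2l // ger0_norm ?subr_ge0 ?(ltW x1) // lerBlDl.
  by apply: le_trans x2 _; rewrite -[X in _ <= _ + X]dk addrC subrK.
rewrite big_ord_recr /= mulrDr.
move: IH step; set I1 := \int[mu]_(_ in _) _; set I2 := \int[mu]_(_ in _) _.
set s := n%:R^-1 * \sum_(i < k) _ => IH step.
rewrite -natr1 (mulrDl k%:R) mul1r.
apply: le_trans (lerD IH step); apply: le_trans (ler_normD _ _).
rewrite le_eqVlt; apply/orP; left; apply/eqP; congr `|_|; ring.
Qed.

Lemma lipschitz_integralE g M a b : lipschitz M g ->
  (\int[mu]_(x in `[a, b]) (g x)%:E = (\int[mu]_(x in `[a, b]) g x)%R%:E)%E.
Proof.
by move=> gM; rewrite fineK //; apply: integrable_fin_num => //; apply: lipschitz_integrable gM.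
Qed.

End Riemann.

(** * The Weyl sum and its reduction modulo a prime *)

Section Absh.
Variable R : realType.

Lemma cos_lipschitz : lipschitz R 1 (@cos R).
Proof.
suff H (x y : R) : x <= y -> `|cos y - cos x| <= y - x.
  move=> x y; rewrite mul1r; have [xy|/ltW yx] := lerP x y.
    by rewrite distrC; exact: H.
  exact: H.
move=> xy; have [c _ ->] : exists2 c, c \in `[x, y]%R & cos y - cos x = - sin c * (y - x).
  apply: (@MVT_segment R cos (fun z => - sin z)) => //.
  by apply: continuous_subspaceT => z; exact: continuous_cos.
rewrite normrM normrN (ger0_norm (_ : 0 <= y - x)) ?subr_ge0 //.
by rewrite -[leRHS]mul1r ler_wpM2r ?subr_ge0 // sin_max.
Qed.

Lemma sin_lipschitz : lipschitz R 1 (@sin R).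
Proof. by move=> x y; rewrite -!cosBpihalf; have := cos_lipschitz (x - pi / 2) (y - pi / 2); rewrite opprB addrA subrK. Qed.

Lemma hypot_le (c s c' s' : R) :
  Num.sqrt (c ^+ 2 + s ^+ 2) <= Num.sqrt (c' ^+ 2 + s' ^+ 2) + (`|c - c'| + `|s - s'|).
Proof.
set r := Num.sqrt (c' ^+ 2 + _).
have r0 : 0 <= r by exact: sqrtr_ge0.
have rE : r ^+ 2 = c' ^+ 2 + s' ^+ 2 by rewrite sqr_sqrtr // addr_ge0 ?sqr_ge0.
have u0 := normr_ge0 (c - c'); have v0 := normr_ge0 (s - s').
rewrite -(@ler_pXn2r _ 2) ?nnegrE ?sqrtr_ge0 ?addr_ge0 //.
rewrite sqr_sqrtr ?addr_ge0 ?sqr_ge0 //.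
have rc : `|c'| <= r by rewrite -sqrtr_sqr ler_wsqrtr // lerDl sqr_ge0.
have rs : `|s'| <= r by rewrite -sqrtr_sqr ler_wsqrtr // lerDr sqr_ge0.
have hc : `|c| <= `|c'| + `|c - c'| by rewrite -{1}(subrKC c' c) ler_normD.
have hs : `|s| <= `|s'| + `|s - s'| by rewrite -{1}(subrKC s' s) ler_normD.
rewrite -(real_normK (num_real c)) -(real_normK (num_real s)).
apply: (@le_trans _ _ ((`|c'| + `|c - c'|) ^+ 2 + (`|s'| + `|s - s'|) ^+ 2)).
  by apply: lerD; apply: lerXn2r => //; rewrite nnegrE ?addr_ge0.
rewrite -(real_normK (num_real c')) -(real_normK (num_real s')) in rE.
have h1 : `|c'| * `|c - c'| <= r * `|c - c'| by rewrite ler_wpM2r.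
have h2 : `|s'| * `|s - s'| <= r * `|s - s'| by rewrite ler_wpM2r.
have h3 : 0 <= `|c - c'| * `|s - s'| by rewrite mulr_ge0.
nra.
Qed.

(** Both bounds are included so that the class is closed under products; the
    constant serves all sections in either variable at once. *)
Definition bounded_lipschitz2 (g : R -> R -> R) := exists M, [/\ 0 <= M, (forall x y, `|g x y| <= M) &
  forall x y x' y', `|g x y - g x' y'| <= M * (`|x - x'| + `|y - y'|)].

Lemma bounded_lipschitz2_mul g k : bounded_lipschitz2 g -> bounded_lipschitz2 k -> bounded_lipschitz2 (fun x y => g x y * k x y).
Proof.
move=> [M [M0 gM gL]] [K [K0 kK kL]]; exists (2 * M * K); split=> [|x y|x y x' y'].
- by rewrite !mulr_ge0.
- rewrite normrM; apply: (@le_trans _ _ (M * K)); first by rewrite ler_pM.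
  by rewrite -mulrA ler_peMl ?mulr_ge0 // ler1n.
- have -> : g x y * k x y - g x' y' * k x' y' =
    g x y * (k x y - k x' y') + (g x y - g x' y') * k x' y' by ring.
  apply: le_trans (ler_normD _ _) _; rewrite !normrM.
  have := ler_pM (normr_ge0 _) (normr_ge0 _) (gM x y) (kL x y x' y').
  have := ler_pM (normr_ge0 _) (normr_ge0 _) (gL x y x' y') (kK x' y').
  set u := _ + `|y - y'|; lra.
Qed.

Lemma bounded_lipschitz2_exp g n : bounded_lipschitz2 g -> bounded_lipschitz2 (fun x y => g x y ^+ n).
Proof.
move=> gJ; elim: n => [|n IH].
  exists 1; split=> // [x y|x y x' y']; first by rewrite expr0 normr1.
  by rewrite !expr0 subrr normr0 mul1r addr_ge0.
rewrite (_ : (fun x y => _) = (fun x y => g x y * g x y ^+ n)); first exact: bounded_lipschitz2_mul.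
by apply/funext => x; apply/funext => y; rewrite exprS.
Qed.

Lemma bounded_lipschitz2_affine g B M a b : 0 <= B -> (forall x, `|g x| <= B) -> lipschitz R M g ->
  bounded_lipschitz2 (fun x y => g (a * x + b * y)).
Proof.
move=> B0 gB gM; have M0 := lipschitz_ge0 _ _ _ gM.
exists (B + M * (`|a| + `|b|)); split=> [|x y|x y x' y'].
- by rewrite addr_ge0 // mulr_ge0 // addr_ge0.
- by apply: le_trans (gB _) _; rewrite lerDl mulr_ge0 // addr_ge0.
apply: le_trans (gM _ _) _.
have -> : a * x + b * y - (a * x' + b * y') = a * (x - x') + b * (y - y') by ring.
have h : `|a * (x - x') + b * (y - y')| <= (`|a| + `|b|) * (`|x - x'| + `|y - y'|).
  apply: le_trans (ler_normD _ _) _; rewrite !normrM.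
  move: (normr_ge0 a) (normr_ge0 b) (normr_ge0 (x - x')) (normr_ge0 (y - y')).
  move: `|a| `|b| `|x - x'| `|y - y'| => p q u v p0 q0 u0 v0.
  have := mulr_ge0 p0 v0; have := mulr_ge0 q0 u0; lra.
have := ler_wpM2l M0 h.
have : 0 <= B * (`|x - x'| + `|y - y'|) by rewrite mulr_ge0 // addr_ge0.
set u := _ + `|y - y'|; lra.
Qed.

Section FixedPY.
Variables P Y : R.
Let N := Num.truncn P.

(** The smooth numbers as a finite set of ordinals, to which the counting lemmas
    apply. *)
Definition smooth_set : {set 'I_N.+1} := [set x : 'I_N.+1 | `[< smooth P Y (x : nat) >]].

Definition re_h (al : R) := \sum_(x in smooth_set) cos (2 * pi * (al * x%:R ^+ 4)).
Definition im_h (al : R) := \sum_(x in smooth_set) sin (2 * pi * (al * x%:R ^+ 4)).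

Lemma smooth_set_ord0 : ord0 \notin smooth_set.
Proof. by rewrite inE; apply/asboolP => -[]. Qed.

Lemma abshE al : absh P Y al = Num.sqrt (re_h al ^+ 2 + im_h al ^+ 2).
Proof.
rewrite /absh /h. rewrite (fsbig_finite _ _ (finite_smooth P Y)).
rewrite (perm_big [seq val x | x <- enum smooth_set]) /=; last first.
  apply: uniq_perm; first exact: finmap.fset_uniq.
    by rewrite map_inj_uniq ?enum_uniq //; exact: val_inj.
  move=> x; rewrite in_fset_set; last exact: finite_smooth.
  apply/idP/mapP => [|[y + ->]].
    move=> /set_mem xs; have xN : (x < N.+1)%N.
      case: xs => x0 xP _; rewrite ltnS /N truncn_ge_nat //; apply: le_trans xP; exact: ler0n.
    by exists (Ordinal xN) => //; rewrite mem_enum inE; apply/asboolP.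
  by rewrite mem_enum finset.inE => /asboolP ?; exact: mem_set.
rewrite big_map big_enum /=.
have -> : \sum_(x in smooth_set) e (al * (x : nat)%:R ^+ 4) = complex.Complex (re_h al) (im_h al).
  rewrite /re_h /im_h.
  by elim/big_rec3: _ => [//|x u v w _ ->].
by [].
Qed.

Lemma absh_ge0 al : 0 <= absh P Y al.
Proof. by rewrite abshE sqrtr_ge0. Qed.

Lemma absh_sqr al : absh P Y al ^+ 2 = re_h al ^+ 2 + im_h al ^+ 2.
Proof. by rewrite abshE sqr_sqrtr // addr_ge0 ?sqr_ge0. Qed.

Lemma absh_N al : absh P Y (- al) = absh P Y al.
Proof.
rewrite !abshE /re_h /im_h; congr (Num.sqrt (_ ^+ 2 + _)).
  by apply: eq_bigr => x _; rewrite mulNr mulrN cosN.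
rewrite (eq_bigr (fun x : 'I_N.+1 => - sin (2 * pi * (al * x%:R ^+ 4)))); last first.
  by move=> x _; rewrite mulNr mulrN sinN.
by rewrite sumrN sqrrN.
Qed.

Lemma absh_lipschitz : exists M, lipschitz R M (absh P Y).
Proof.
pose K := \sum_(x in smooth_set) (2 * pi * x%:R ^+ 4) : R.
have piR : 0 < pi :> R := pi_gt0 R.
have trig (t : R -> R) : lipschitz R 1 t -> lipschitz R K (fun al => \sum_(x in smooth_set) t (2 * pi * (al * x%:R ^+ 4))).
  move=> tL u v; rewrite -sumrB; apply: le_trans (ler_norm_sum _ _ _) _.
  rewrite mulr_suml; apply: ler_sum => x _; apply: le_trans (tL _ _) _.
  rewrite mul1r -mulrBr -mulrBl normrM (normrM (u - v)).
  rewrite (ger0_norm (_ : 0 <= 2 * pi)) ?mulr_ge0 ?(ltW piR) // (ger0_norm (_ : 0 <= x%:R ^+ 4)) ?exprn_ge0 //.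
  by rewrite le_eqVlt; apply/orP; left; apply/eqP; ring.
have hc := trig _ cos_lipschitz; have hs := trig _ sin_lipschitz.
exists (2 * K) => u v; rewrite !abshE ler_norml lerBlDl.
have h1 := hypot_le (re_h u) (im_h u) (re_h v) (im_h v).
have h2 := hypot_le (re_h v) (im_h v) (re_h u) (im_h u).
have := hc u v; have := hs u v; have := hc v u; have := hs v u.
rewrite (distrC v u) -/(re_h u) -/(re_h v) -/(im_h u) -/(im_h v) => a1 a2 a3 a4.
apply/andP; split; lra.
Qed.

Lemma absh_bounded : exists2 B, 0 <= B & forall al, `|absh P Y al| <= B.
Proof.
pose K := #|smooth_set|%:R : R; exists (2 * K); first by rewrite mulr_ge0.
move=> al; rewrite ger0_norm ?absh_ge0 // abshE.
have bnd (t : R -> R) : (forall x, `|t x| <= 1) ->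
   `|\sum_(x in smooth_set) t (2 * pi * (al * x%:R ^+ 4))| <= K.
  move=> t1; apply: le_trans (ler_norm_sum _ _ _) _.
  by rewrite /K -sum1_card natr_sum; apply: ler_sum.
have := hypot_le (re_h al) (im_h al) 0 0.
rewrite !expr0n /= addr0 sqrtr0 add0r !subr0 => /le_trans; apply.
rewrite mulr_natl mulr2n; apply: lerD; apply: bnd; [exact: cos_max|exact: sin_max].
Qed.

Lemma absh_bounded_lipschitz2 a b : bounded_lipschitz2 (fun x y => absh P Y (a * x + b * y)).
Proof.
have [M hM] := absh_lipschitz; have [B B0 hB] := absh_bounded.
exact: bounded_lipschitz2_affine B0 hB hM.
Qed.

Section ModP.
Variable p : nat.
Hypothesis pp : prime p.

Definition absh_mod (z : 'F_p) : R := absh P Y ((z : nat)%:R / p%:R).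

Lemma trig_mod (m : nat) (x : nat) :
  2 * pi * (m%:R / p%:R * x%:R ^+ 4) = 2 * pi * (m * x ^ 4)%N%:R / p%:R :> R.
Proof. by rewrite natrM natrX; field; exact: p_neq0. Qed.

Lemma absh_mod_sqr (z : 'F_p) : absh_mod z ^+ 2 =
  \sum_(x in smooth_set) \sum_(y in smooth_set) cosp R p ((x%:R ^+ 4 - y%:R ^+ 4) * z).
Proof.
rewrite /absh_mod absh_sqr /re_h /im_h.
under eq_bigr do rewrite trig_mod cos_cosp // natrM natrX natr_Zp.
under [X in _ + X ^+ 2]eq_bigr do rewrite trig_mod sin_sinp // natrM natrX natr_Zp.
rewrite !expr2 !big_distrlr /= -big_split /=; apply: eq_bigr => x _.
rewrite -big_split /=; apply: eq_bigr => y _.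
by rewrite mulrBl cospB // !(mulrC z).
Qed.

Lemma absh_mod_ge0 z : 0 <= absh_mod z. Proof. exact: absh_ge0. Qed.

Lemma absh_mod_nat (m : nat) : absh P Y (m%:R / p%:R) = absh_mod m%:R.
Proof.
rewrite /absh_mod !abshE /re_h /im_h.
by congr (Num.sqrt (_ ^+ 2 + _ ^+ 2)); apply: eq_bigr => x _;
  rewrite !trig_mod ?(cos_cosp, sin_sinp) // !natrM natr_Zp.
Qed.

(** Only the residue of [m] matters, as the frequencies [x ^ 4] are integers. *)
Lemma absh_mod_int (m : int) : absh P Y (m%:~R / p%:R) = absh_mod m%:~R.
Proof.
case: m => m; first by rewrite -!pmulrn absh_mod_nat.
rewrite NegzE !mulrNz mulNr absh_N -!pmulrn absh_mod_nat.
apply/esym; apply: (f_even R p N smooth_set _ pp absh_mod_ge0 absh_mod_sqr).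
Qed.
End ModP.
End FixedPY.
End Absh.

Section Discretise.
Variable R : realType.
Notation mu := (@lebesgue_measure R).

Lemma sum_Fp (p : nat) (F : nat -> R) : prime p ->
  \sum_(i < p) F i = \sum_(z : 'F_p) F (z : nat).
Proof. by move=> pp; rewrite -!(big_mkord xpredT F) Fp_cast. Qed.

Lemma avg_le_integral (P Y : R) (t : nat) :
  exists M, forall p, prime p ->
   ((avg R p (fun z => absh_mod R P Y p z ^+ t) - M / p%:R)%:E <= moment t P Y)%E.
Proof.
have [M [M0 _ hM]] := bounded_lipschitz2_exp R _ t (absh_bounded_lipschitz2 R P Y 1 0).
have L : lipschitz R M (fun x => absh P Y x ^+ t).
  by move=> x y; have := hM x 0 y 0; rewrite !mul0r !mul1r !addr0 subrr normr0 addr0.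
exists M => p pp; rewrite /moment (lipschitz_integralE _ _ _ _ _ L) lee_fin.
have := riemann_sum _ _ _ _ L (prime_gt0 pp); rewrite ler_distl => /andP[h _].
rewrite /avg -(sum_Fp p (fun i => absh P Y (i%:R / p%:R) ^+ t) pp).
exact: h.
Qed.

(** This supplies the integrability of the inner integral, and lets a Riemann sum
    be used in each variable in turn. *)
Lemma lipschitz_Rintegral (g : R -> R -> R) M : 0 <= M ->
  (forall x y x' y', `|g x y - g x' y'| <= M * (`|x - x'| + `|y - y'|)) ->
  lipschitz R M (fun x => \int[mu]_(y in `[0, 1]) g x y).
Proof.
move=> M0 gM.
have L x : lipschitz R M (g x) by move=> y y'; have := gM x y x y'; rewrite subrr normr0 add0r.
suff H x x' : \int[mu]_(y in `[0, 1]) g x y <= \int[mu]_(y in `[0, 1]) g x' y + M * `|x - x'|.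
  move=> x x'; rewrite ler_distl H lerBlDr andbT; have := H x' x; by rewrite distrC.
have Lc : lipschitz R 0 (fun=> M * `|x - x'|) by move=> y y'; rewrite subrr normr0 mul0r.
have ic := lipschitz_integrable _ _ _ 0 1 Lc.
have ig z := lipschitz_integrable _ _ _ 0 1 (L z).
have <- : \int[mu]_(y in `[0, 1]) (M * `|x - x'|) = M * `|x - x'|.
  rewrite Rintegral_cst // [X in fine X](lebesgue_measure_itv `[0, 1]) /= lte_fin ltr01 /=.
  by rewrite subr0 mulr1.
rewrite -RintegralD //; apply: le_Rintegral => //.
  apply: (@lipschitz_integrable _ M (fun y => g x' y + M * `|x - x'|)) => y y'.
  by rewrite opprD addrACA subrr addr0; exact: L.
move=> y _; have := gM x y x' y; rewrite subrr normr0 addr0 ler_distl => /andP[_].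
by [].
Qed.

Lemma entangled_le (P Y : R) (a b c d : int) :
  exists M, forall p, prime p ->
   (entangled P Y a b c d <= (p%:R^-1 ^+ 2 * (\sum_(j : 'F_p) \sum_(k : 'F_p)
      absh_mod R P Y p (a%:~R * j) ^+ 7 * absh_mod R P Y p (b%:~R * k) ^+ 7
       * absh_mod R P Y p (c%:~R * j + d%:~R * k) ^+ 7) + M / p%:R)%:E)%E.
Proof.
pose g x y : R := (absh P Y (a%:~R * x) * absh P Y (b%:~R * y)
       * absh P Y (c%:~R * x + d%:~R * y)) ^+ 7.
have gJ : bounded_lipschitz2 R g.
  apply: bounded_lipschitz2_exp; apply: bounded_lipschitz2_mul; last exact: absh_bounded_lipschitz2.
  apply: bounded_lipschitz2_mul.
    rewrite (_ : (fun x _ => _) = (fun x y => absh P Y (a%:~R * x + 0 * y))); first exact: absh_bounded_lipschitz2.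
    by apply/funext => x; apply/funext => y; rewrite mul0r addr0.
  rewrite (_ : (fun _ y => _) = (fun x y => absh P Y (0 * x + b%:~R * y))); first exact: absh_bounded_lipschitz2.
  by apply/funext => x; apply/funext => y; rewrite mul0r add0r.
have [M [M0 _ gM]] := gJ; exists (2 * M) => p pp.
have Ly x : lipschitz R M (g x) by move=> y y'; have := gM x y x y'; rewrite subrr normr0 add0r.
have Lx := lipschitz_Rintegral g M M0 gM.
rewrite /entangled.
have -> : (fun alpha : R => \int[mu]_(beta in `[0%R, 1%R]) (g alpha beta)%:E)%E =
   (fun alpha => (\int[mu]_(beta in `[0, 1]) g alpha beta)%R%:E)%E.
  by apply/funext => x; rewrite (lipschitz_integralE _ _ _ _ _ (Ly x)).
rewrite (lipschitz_integralE _ _ _ _ _ Lx) lee_fin.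
have p0 := prime_gt0 pp.
have pR : 0 < p%:R :> R by rewrite ltr0n.
have := riemann_sum _ _ _ _ Lx p0; rewrite ler_distl => /andP[_ h1].
apply: le_trans h1 _.
have h2 (i : 'I_p) : \int[mu]_(y in `[0, 1]) g (i%:R / p%:R) y <=
   p%:R^-1 * \sum_(k < p) g (i%:R / p%:R) (k%:R / p%:R) + M / p%:R.
  by have := riemann_sum _ _ _ _ (Ly (i%:R / p%:R)) p0; rewrite ler_distl => /andP[_].
have h3 := ler_sum _ (fun (i : 'I_p) (_ : xpredT i) => h2 i).
have ip : 0 <= p%:R^-1 :> R by rewrite invr_ge0 ltW.
have {}h3 := ler_wpM2l ip (h3 (index_enum _)).
have -> : \sum_(j : 'F_p) \sum_(k : 'F_p)
      absh_mod R P Y p (a%:~R * j) ^+ 7 * absh_mod R P Y p (b%:~R * k) ^+ 7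
       * absh_mod R P Y p (c%:~R * j + d%:~R * k) ^+ 7
    = \sum_(j < p) \sum_(k < p) g (j%:R / p%:R) (k%:R / p%:R).
  rewrite (sum_Fp _ (fun j => \sum_(k < p) g (j%:R / p%:R) (k%:R / p%:R)) pp).
  apply: eq_bigr => j _; rewrite (sum_Fp _ (fun k => g (j%:R / p%:R) (k%:R / p%:R)) pp).
  apply: eq_bigr => k _; rewrite /g !exprMn.
  have cast (m : int) (z : 'F_p) : (m * (z : nat)%:Z)%:~R = m%:~R * z :> 'F_p.
    by rewrite intrM -pmulrn natr_Zp.
  have am (m : int) (z : 'F_p) : absh P Y (m%:~R * ((z : nat)%:R / p%:R)) = absh_mod R P Y p (m%:~R * z).
    by rewrite -cast -absh_mod_int // intrM -pmulrn mulrA.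
  rewrite !am; congr (_ * _ * _ ^+ 7).
  by rewrite -!cast -intrD -absh_mod_int // intrD !intrM mulrDl !mulrA -!pmulrn.
apply: le_trans (lerD h3 (lexx _)) _.
rewrite big_split /= -mulr_sumr sumr_const card_ord -[_ *+ p]mulr_natl.
rewrite le_eqVlt; apply/orP; left; apply/eqP; field; by rewrite gt_eqF.
Qed.

End Discretise.

(** * Exponents, and the entangled moment *)

Section Powers.
Variable R : realType.

Lemma powR_mul_add (P x y : R) : 0 < P -> P `^ x * P `^ y = P `^ (x + y).
Proof. by move=> P0; rewrite powRD //; apply/implyP => _; rewrite gt_eqF. Qed.

Lemma powR_exp (P x : R) (n : nat) : (P `^ x) ^+ n = P `^ (x * n%:R).
Proof. by rewrite powRrM powR_mulrn // powR_ge0. Qed.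

(** [D] will bound the number of triples of signed divisors of a nonzero third
    difference. *)
Lemma divisor_cube_bound (eps : R) : 0 < eps -> exists2 K : R, 0 <= K &
  forall P : R, 1 <= P -> exists D : nat,
    (forall m, (0 < m <= 4 * Num.truncn P ^ 4)%N -> ((2 * size (divisors m)) ^ 3 <= D)%N)
    /\ D%:R <= K * P `^ eps.
Proof.
move=> eps0; (* [tau m <= c * P ^ (4 / k)] for [m <= 4 * P ^ 4], and the cube gives [12 / k] *)
pose k := (Num.truncn (12 / eps)).+1.
have k0 : 0 < k%:R :> R by rewrite ltr0n.
have keps : 12 / k%:R <= eps.
  rewrite ler_pdivrMr // mulrC -ler_pdivrMr //; apply: ltW.
  exact: truncnS_gt.
have [C hC] := divisor_bound k.
pose c : R := 4 * C%:R + 1.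
have c1 : 1 <= c by rewrite /c lerDr mulr_ge0.
have c0 : 0 <= c by apply: le_trans c1.
exists (8 * c ^+ 3); first by rewrite mulr_ge0 ?exprn_ge0.
move=> P P1; have P0 : 0 < P by apply: lt_le_trans P1.
pose B := 8 * c ^+ 3 * P `^ (12 / k%:R).
have B0 : 0 <= B by rewrite !mulr_ge0 ?exprn_ge0 ?powR_ge0.
exists (Num.truncn B); split; last first.
  apply: (@le_trans _ _ B); first by rewrite truncn_le.
  by rewrite ler_wpM2l ?mulr_ge0 ?exprn_ge0 // ler_powR.
move=> m /andP[m0 mN]; rewrite truncn_ge_nat // natrX natrM.
have tau : (size (divisors m))%:R <= c * P `^ (4 / k%:R).
  rewrite -(@ler_pXn2r _ k) ?nnegrE ?mulr_ge0 ?powR_ge0 // -natrX exprMn powR_exp.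
  rewrite divfK ?gt_eqF // powR_mulrn ?(ltW P0) //.
  apply: (@le_trans _ _ (C * (4 * Num.truncn P ^ 4))%:R).
    by rewrite ler_nat (leq_trans (hC m m0)) // leq_mul2l mN orbT.
  have NP : (Num.truncn P)%:R <= P by rewrite truncn_le ltW.
  rewrite mulnA natrM natrX; apply: ler_pM => //.
    rewrite natrM mulrC /k exprS -[leLHS]mulr1; apply: ler_pM => //.
      by rewrite /c lerDl.
    exact: exprn_ege1.
  by apply: lerXn2r => //; rewrite nnegrE // ltW.
apply: (@le_trans _ _ ((2 * (c * P `^ (4 / k%:R))) ^+ 3)).
  apply: lerXn2r; rewrite ?nnegrE ?mulr_ge0 ?powR_ge0 //.
  by rewrite ler_wpM2l.
rewrite !exprMn powR_exp /B mulrA (_ : 4 / k%:R * 3 = 12 / k%:R); last by ring.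
by rewrite le_eqVlt; apply/orP; left; apply/eqP; ring.
Qed.

(** This is the numerical condition that makes the diagonal term admissible. *)
Lemma Delta7_10 : Delta 7 + Delta 10 <= 1 + 2^-1 * Delta 10 :> R.
Proof. rewrite /Delta; lra. Qed.

Lemma Delta7_ge0 : 0 <= Delta 7 :> R. Proof. rewrite /Delta; lra. Qed.
Lemma Delta10_ge0 : 0 <= Delta 10 :> R. Proof. rewrite /Delta; lra. Qed.

(** The constants [u] and [v] will be 60 and 900; they are kept abstract because
    numerals are unary.  In the second estimate the exponents add up to
    [4 + eps + (6 + Delta 10) + 16], exactly those of [W ^ 2]. *)
Lemma cubic_hypotheses (u v P N A7 A10 A12 D K Kd eps : R) :
  0 <= u -> 0 <= v ->
  1 <= P -> 0 <= N <= P -> 0 <= eps -> 1 <= K -> 0 <= Kd ->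
  0 <= A7 <= K * P `^ (3 + Delta 7) -> 0 <= A10 <= K * P `^ (6 + Delta 10) ->
  0 <= A12 <= K * P `^ 8 -> 0 <= D <= Kd * P `^ eps ->
  let W := (u * K ^+ 2 + v * Kd * K ^+ 3 + 1) * P `^ (13 + 2^-1 * Delta 10 + eps / 2) in
  u * N ^+ 3 * A7 * A10 <= W /\
  v * N ^+ 4 * D * (A10 * A12 ^+ 2) <= W ^+ 2.
Proof.
move=> u0 v0 P1 /andP[N0 NP] eps0 K1 Kd0 /andP[A70 h7] /andP[A100 h10] /andP[A120 h12] /andP[D0 hD] W.
have P0 : 0 < P by apply: lt_le_trans P1.
have K0 : 0 <= K by apply: le_trans K1.
have pw x : 0 <= P `^ x by exact: powR_ge0.
have NX n : N ^+ n <= P `^ n%:R.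
  by rewrite powR_mulrn ?(ltW P0) // lerXn2r // nnegrE ltW.
set Wc := u * K ^+ 2 + v * Kd * K ^+ 3 + 1 in W *.
have a0 : 0 <= u * K ^+ 2 by rewrite mulr_ge0 ?exprn_ge0.
have b0 : 0 <= v * Kd * K ^+ 3 by rewrite !mulr_ge0 ?exprn_ge0.
have Wc1 : 1 <= Wc by rewrite /Wc; lra.
split.
  apply: (@le_trans _ _ (u * P `^ 3%:R * (K * P `^ (3 + Delta 7)) * (K * P `^ (6 + Delta 10)))).
    apply: ler_pM; rewrite ?mulr_ge0 ?exprn_ge0 //.
    apply: ler_pM; rewrite ?mulr_ge0 ?exprn_ge0 //.
    by rewrite ler_wpM2l.
  have -> : u * P `^ 3%:R * (K * P `^ (3 + Delta 7)) * (K * P `^ (6 + Delta 10)) =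
    u * K ^+ 2 * (P `^ 3%:R * P `^ (3 + Delta 7) * P `^ (6 + Delta 10)) by ring.
  rewrite !powR_mul_add // /W; apply: ler_pM => //; first by rewrite /Wc; lra.
  rewrite ler_powR //; have := Delta7_10; move: (Delta 7) (Delta 10) => x y; lra.
apply: (@le_trans _ _ (v * P `^ 4%:R * (Kd * P `^ eps) * ((K * P `^ (6 + Delta 10)) * (K * P `^ 8) ^+ 2))).
  apply: ler_pM; rewrite ?mulr_ge0 ?exprn_ge0 //.
    apply: ler_pM; rewrite ?mulr_ge0 ?exprn_ge0 //.
    by rewrite ler_wpM2l.
  apply: ler_pM; rewrite ?mulr_ge0 ?exprn_ge0 //.
  by rewrite lerXn2r // nnegrE ?mulr_ge0.
have -> : v * P `^ 4%:R * (Kd * P `^ eps) * ((K * P `^ (6 + Delta 10)) * (K * P `^ 8) ^+ 2) =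
  v * Kd * K ^+ 3 * (P `^ 4%:R * P `^ eps * P `^ (6 + Delta 10) * (P `^ 8) ^+ 2) by ring.
rewrite powR_exp !powR_mul_add // /W exprMn powR_exp; apply: ler_pM => //.
  apply: (@le_trans _ _ Wc); first by rewrite /Wc; lra.
  by rewrite expr2 ler_peMl // (le_trans _ Wc1).
by rewrite ler_powR //; move: (Delta 10) => x; lra.
Qed.

Lemma le_sum4 (x y z w : R) : 0 <= x -> 0 <= y -> 0 <= z -> 0 <= w ->
  let S := x + y + z + w in
  [/\ x <= S, y <= S, z <= S & w <= S] /\ [/\ x + w <= S, y + w <= S & z + w <= S].
Proof. by move=> x0 y0 z0 w0 /=; split; split; lra. Qed.

Lemma exponent7 : 7%:R - 4 + Delta 7 = 3 + Delta 7 :> R.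
Proof. move: (Delta 7) => x; lra. Qed.
Lemma exponent10 : 10%:R - 4 + Delta 10 = 6 + Delta 10 :> R.
Proof. move: (Delta 10) => x; lra. Qed.
Lemma exponent12 : 12%:R - 4 + Delta 12 = 8 :> R.
Proof. rewrite /Delta; lra. Qed.

Lemma exponent_max : 1 + (3 + Delta 7) <= 3 + 2 :> R. Proof. rewrite /Delta; lra. Qed.

Lemma exponent_final (x t : R) : 0 <= x -> 0 < t ->
  [/\ 0 <= 13 + 2^-1 * x + t, 3 + 2 + 8 <= 13 + 2^-1 * x + t &
    t / 6 * 3 + (13 + 2^-1 * x + t / 2) <= 13 + 2^-1 * x + t].
Proof. by move=> x0 t0; split; lra. Qed.

End Powers.

Lemma summands_lt (m n a b c d p : nat) : (m + n + a + b + c + d < p)%N ->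
  [/\ (m < p)%N, (n <= p)%N & [/\ (a < p)%N, (b < p)%N, (c < p)%N & (d < p)%N]].
Proof. by move=> h; split; [lia|lia|split; lia]. Qed.

Theorem theorem2p2 (R : realType) (eta : R) (eta_gt0 : 0 < eta)
    (eta_le1 : eta <= 1) (eta_adm : admissible eta)
    (a b c d : int) (a_neq0 : a != 0) (b_neq0 : b != 0)
    (c_neq0 : c != 0) (d_neq0 : d != 0) (eps : R) (eps_gt0 : 0 < eps) :
  exists C P0 : R, forall P : R, P0 <= P -> 1 <= P ->
    (entangled P (P `^ eta) a b c d
       <= (C * P `^ (13 + 2^-1 * Delta 10 + eps))%:E)%E.
Proof.
have [C7 [P7 h7]] := eta_adm 7%N isT.
have [C10 [P10 h10]] := eta_adm 10%N isT.
have [C12 [P12 h12]] := eta_adm 12%N isT.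
have [Kd Kd0 hKd] := divisor_cube_bound R eps eps_gt0.
pose K := `|C7| + `|C10| + `|C12| + 1.
have K1 : 1 <= K by rewrite /K lerDr !addr_ge0.
have K0 : 0 <= K by apply: le_trans K1.
(* [L] levels with ratio [P ^ (eps / 6)] lead from [P ^ 3] beyond [A_7] *)
pose L := (Num.truncn (2 / (eps / 6))).+1.
have hL : 2 <= eps / 6 * L%:R.
  by rewrite mulrC -ler_pdivrMr ?divr_gt0 // ltW // truncnS_gt.
have [u u0 uE] : exists2 u : R, 0 <= u & u = 60 by exists 60.
have [v v0 vE] : exists2 v : R, 0 <= v & v = 900.
  by exists 900; [exact: (ler0n R 900)|reflexivity].
pose Wc := u * K ^+ 2 + v * Kd * K ^+ 3 + 1.
exists (K + L%:R * Wc + 1), (`|P7| + `|P10| + `|P12| + K) => P PP P1.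
have P0 : 0 < P by apply: lt_le_trans P1.
have [[_ _ _ _] [k7 k10 k12]] := le_sum4 R _ _ _ _ (normr_ge0 C7) (normr_ge0 C10)
  (normr_ge0 C12) (ler01 : 0 <= 1).
have [PP7 PP10 PP12 PK] : [/\ P7 <= P, P10 <= P, P12 <= P & K <= P].
  have [[l7 l10 l12 lK] _] := le_sum4 R _ _ _ _ (normr_ge0 P7) (normr_ge0 P10) (normr_ge0 P12) K0.
  split; [exact: le_trans (ler_norm _) (le_trans l7 PP)|exact: le_trans (ler_norm _) (le_trans l10 PP)
    |exact: le_trans (ler_norm _) (le_trans l12 PP)|exact: le_trans lK PP].
set Y := P `^ eta.
have hY : 1 <= Y <= P `^ eta.
  by rewrite lexx andbT -(powRr0 P) ler_powR // ltW.
have [M7 hM7] := avg_le_integral R P Y 7.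
have [M10 hM10] := avg_le_integral R P Y 10.
have [M12 hM12] := avg_le_integral R P Y 12.
have [ME hME] := entangled_le R P Y a b c d.
set N := Num.truncn P.
have N0 : (0 < N)%N by rewrite truncn_gt0.
have NP : N%:R <= P by rewrite truncn_le ltW.
pose Mb := `|M7| + `|M10| + `|M12| + `|ME|.
have [[m7 m10 m12 mE] _] := le_sum4 R _ _ _ _ (normr_ge0 M7) (normr_ge0 M10) (normr_ge0 M12)
  (normr_ge0 ME).
(* large enough for the size conditions, for all discretisation errors to be at
   most 1, and for [a], [b], [c], [d] to be units *)
have [p pX pp] := prime_above (8 * N ^ 4 + (Num.truncn Mb).+1 + `|a| + `|b| + `|c| + `|d|)%N.
have {pX} [Np Mbp' [ap bp cp dp]] := summands_lt _ _ _ _ _ _ _ pX.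
have p0 : 0 < p%:R :> R by rewrite ltr0n prime_gt0.
have Mbp : Mb <= p%:R.
  apply: ltW; apply: lt_le_trans (truncnS_gt Mb) _; by rewrite ler_nat.
have Mp M : `|M| <= Mb -> M / p%:R <= 1.
  by move=> h; rewrite ler_pdivrMr // mul1r (le_trans (ler_norm _)) // (le_trans h).
have Fp_neq0 (m : int) : m != 0 -> (`|m| < p)%N -> (m%:~R : 'F_p) != 0.
  by move=> m0 mp; apply: contra_neq m0 => /intr_Fp_eq0; apply.
pose f := absh_mod R P Y p.
have f0 z : 0 <= f z := absh_mod_ge0 R P Y p z.
have f2 := absh_mod_sqr R P Y p pp.
have avg_bound t Ct M e' : `|Ct| + 1 <= K -> `|M| <= Mb -> 0 <= e' ->
    ((avg R p (fun z => f z ^+ t) - M / p%:R)%:E <= moment t P Y)%E ->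
    (moment t P Y <= (Ct * P `^ e')%:E)%E ->
    0 <= avg R p (fun z => f z ^+ t) <= K * P `^ e'.
  move=> hC hM e0 h1 h2; have := le_trans h1 h2; rewrite lee_fin lerBlDl => h.
  apply/andP; split; first by apply: avg_ge0 => z; rewrite exprn_ge0.
  apply: le_trans h _.
  have Pe : 1 <= P `^ e' by rewrite -(powRr0 P) ler_powR.
  apply: (@le_trans _ _ ((`|Ct| + 1) * P `^ e')); last by rewrite ler_wpM2r ?powR_ge0.
  rewrite addrC mulrDl mul1r; apply: lerD; last by apply: le_trans (Mp _ hM) Pe.
  by rewrite ler_wpM2r ?powR_ge0 ?ler_norm.
have {h7} := h7 P Y PP7 P1 hY; rewrite exponent7.
move=> /(avg_bound 7%N C7 M7 _ k7 m7 (addr_ge0 (ler0n R 3) (Delta7_ge0 R)) (hM7 p pp)) b7.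
have {h10} := h10 P Y PP10 P1 hY; rewrite exponent10.
move=> /(avg_bound 10%N C10 M10 _ k10 m10 (addr_ge0 (ler0n R 6) (Delta10_ge0 R)) (hM10 p pp)) b10.
have {h12} := h12 P Y PP12 P1 hY; rewrite exponent12.
move=> /(avg_bound 12%N C12 M12 _ k12 m12 (ler0n R 8) (hM12 p pp)) b12.
have [D [hD hDK]] := hKd P P1.
have bD : 0 <= (D%:R : R) <= Kd * P `^ eps by rewrite ler0n.
have bN : 0 <= (N%:R : R) <= P by rewrite ler0n.
have [hW1 hW2] := cubic_hypotheses R u v P N%:R _ _ _ D%:R K Kd eps u0 v0 P1 bN (ltW eps_gt0) K1 Kd0 b7 b10 b12 bD.
move: hW1 hW2; rewrite /= -/Wc; set W := Wc * _; rewrite uE vE => hW1 hW2.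
have Wc0 : 0 <= Wc.
  by rewrite /Wc !addr_ge0 // !mulr_ge0 ?exprn_ge0.
have W0 : 0 <= W by rewrite mulr_ge0 ?powR_ge0.
pose rho := P `^ (eps / 6).
have rho1 : 1 <= rho by rewrite -(powRr0 P) ler_powR // divr_ge0 // ltW.
have hT : avg R p (fun z => f z ^+ 7) <= P ^+ 3 * rho ^+ L.
  case/andP: b7 => _ /le_trans; apply.
  rewrite powR_exp -(powR_mulrn 3 (ltW P0)) powR_mul_add //.
  apply: (@le_trans _ _ (P `^ 1 * P `^ (3 + Delta 7))).
    by rewrite ler_wpM2r ?powR_ge0 // powRr1 // ltW.
  rewrite powR_mul_add // ler_powR //.
  apply: (@le_trans _ _ (3 + 2)); last first.
    by rewrite lerD2l.
  exact: exponent_max.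
have cub := cubic_moment R p N (smooth_set R P Y) D f pp N0 (smooth_set_ord0 R P Y) Np hD f0 f2
  (P ^+ 3) rho W L (exprn_gt0 3 P0) rho1 W0 hT hW1 hW2.
have ent := entangled_discrete R p N (smooth_set R P Y) f pp f0 f2 _ _ _ _
  (Fp_neq0 a a_neq0 ap) (Fp_neq0 b b_neq0 bp) (Fp_neq0 c c_neq0 cp) (Fp_neq0 d d_neq0 dp).
apply: le_trans (hME p pp) _; rewrite lee_fin.
apply: le_trans (lerD (le_trans ent cub) (Mp ME mE)) _.
set E := 13 + 2^-1 * Delta 10 + eps.
have [E0 E13 Eeps] := exponent_final R _ _ (Delta10_ge0 R) eps_gt0.
rewrite (mulrDl _ 1) (mulrDl K); apply: lerD; last first.
  by rewrite mul1r -(powRr0 P) ler_powR.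
apply: lerD.
  apply: (@le_trans _ _ (P ^+ 3 * (P ^+ 2 * (K * P `^ 8)))).
    rewrite ler_wpM2l ?exprn_ge0 ?(ltW P0) //.
    case/andP: b12 => b0 b12; apply: ler_pM => //.
    by apply: lerXn2r; rewrite ?nnegrE ?(ltW P0) ?ler0n.
  rewrite -!powR_mulrn ?(ltW P0) //.
  rewrite (_ : P `^ 3%:R * (P `^ 2%:R * (K * P `^ 8)) = K * (P `^ 3%:R * P `^ 2%:R * P `^ 8)); last by ring.
  rewrite !powR_mul_add // ler_wpM2l // ler_powR //.
rewrite /W /rho powR_exp.
set e1 := eps / 6 * 3 in Eeps *; set e2 := 13 + _ + eps / 2 in Eeps *.
rewrite -!mulrA ler_wpM2l // mulrCA ler_wpM2l // powR_mul_add //.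
by rewrite ler_powR.
Qed.
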